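(* Let $P,Q,R,S$ be real-valued functions on $[t_0,+\infty)\times(\mathbb{R}\setminus\{0\})\times(\mathbb{R}\setminus\{0\})$, locally integrable in $t$ and continuous in $(u,v)$, and put $B(t,u,v)=P(t,u,v)-S(t,u,v)$. Let $\alpha,\beta$ and, for each $\delta>0$, $P_\delta,Q_\delta,R_\delta,S_\delta,B_{1,\delta},B_{2,\delta}$ be real-valued locally integrable functions on $[t_0,+\infty)$. For $c_1\neq 0$, $c_2\neq 0$, $t\ge t_0$ set $$K_\delta(t,c_1,c_2)=c_1\exp\Bigl\{\int_{t_0}^tP_\delta(s)\,ds+\int_{t_0}^tQ_\delta(\tau)\Bigl[\frac{c_2}{c_1}\exp\Bigl\{-\int_{t_0}^{\tau}B_{1,\delta}(s)\,ds\Bigr\}+\int_{t_0}^{\tau}\exp\Bigl\{-\int_{\zeta}^{\tau}B_{1,\delta}(s)\,ds\Bigr\}R_\delta(\zeta)\,d\zeta\Bigr]d\tau\Bigr\},$$ $$L_\delta(t,c_1,c_2)=c_2\exp\Bigl\{\int_{t_0}^tS_\delta(s)\,ds+\int_{t_0}^tR_\delta(\tau)\Bigl[\frac{c_1}{c_2}\exp\Bigl\{\int_{t_0}^{\tau}B_{2,\delta}(s)\,ds\Bigr\}+\int_{t_0}^{\tau}\exp\Bigl\{\int_{\zeta}^{\tau}B_{2,\delta}(s)\,ds\Bigr\}Q_\delta(\zeta)\,d\zeta\Bigr]d\tau\Bigr\}.$$ Suppose that for some $c_1>0$, $c_2>0$, $\varepsilon>0$ and for every $\delta\in(0,\varepsilon)$,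 $t\ge t_0$, $u\in[\delta,K_\delta(t,c_1,c_2)+\varepsilon]$, $v\in[\delta,L_\delta(t,c_1,c_2)+\varepsilon]$ the inequalities $$\alpha(t)\le P(t,u,v)\le P_\delta(t),\qquad \beta(t)\le S(t,u,v)\le S_\delta(t),$$ $$0\le Q(t,u,v)\le Q_\delta(t),\qquad 0\le R(t,u,v)\le R_\delta(t),\qquad B_{1,\delta}(t)\le B(t,u,v)\le B_{2,\delta}(t)$$ hold. Then every solution $(\phi(t),\psi(t))$ of the system $$\phi'=P(t,\phi,\psi)\phi+Q(t,\phi,\psi)\psi,\qquad \psi'=R(t,\phi,\psi)\phi+S(t,\phi,\psi)\psi,\qquad t\ge t_0,$$ with $\phi(t_0)=c_1$, $\psi(t_0)=c_2$ exists on $[t_0,+\infty)$ and $$\phi(t)>0,\qquad \psi(t)>0,\qquad t\ge t_0.$$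
   Context: A solution of the system on $[t_1,t_2)$ ($t_0\le t_1<t_2\le+\infty$) is a pair $(\phi,\psi)$ of absolutely continuous functions on $[t_1,t_2)$ (locally absolutely continuous) satisfying the system almost everywhere on $[t_1,t_2)$. $[t_0,T)$ is the maximum existence interval of a solution if the solution satisfies the system almost everywhere on $[t_0,T)$ and cannot be continued to the right of $T$ as a solution. ''Exists on $[t_0,+\infty)$'' means that the maximum existence interval is $[t_0,+\infty)$. *)

(* Defs.v *)
From HB Require Import structures.
From mathcomp Require Import all_boot all_order all_algebra.
From mathcomp Require Import all_classical all_reals all_analysis.

Set Implicit Arguments.
Unset Strict Implicit.
Unset Printing Implicit Defensive.

Import Order.TTheory GRing.Theory Num.Theory.
Import numFieldNormedType.Exports.

Local Open Scope classical_set_scope.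
Local Open Scope ring_scope.

(* [lebesgue_measure] is the restriction to Borel sets; its completion is used
   so that functions are only required to be Lebesgue measurable. *)
Notation leb R := (@completed_lebesgue_measure R).

(* The library's [locally_integrable] requires an open domain, hence does not
   apply to [t0, +oo[. *)
Definition loc_integrable (R : realType) (t0 : R) (f : R -> R) : Prop :=
  forall b : R, (leb R).-integrable `[t0, b] (EFin \o f).

Definition abs_continuous (R : realType) (a b : R) (f : R -> R) : Prop :=
  forall e : R, 0 < e -> exists2 d : R, 0 < d &
    forall (n : nat) (x y : 'I_n -> R),
      (forall i, [/\ a <= x i, x i <= y i & y i <= b]) ->
      trivIset [set: 'I_n] (fun i => `]x i, y i[%classic) ->
      \sum_(i < n) (y i - x i) < d ->
      \sum_(i < n) `|f (y i) - f (x i)| < e.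

Definition loc_abs_continuous (R : realType) (t1 : R) (t2 : \bar R)
    (f : R -> R) : Prop :=
  forall b : R, t1 <= b -> (b%:E < t2)%E -> abs_continuous t1 b f.

(* A function on [t0, +oo[ * (R \ {0}) * (R \ {0}) is represented by a total
   function, whose values outside this domain are irrelevant. *)
Definition admissible (R : realType) (t0 : R) (F : R -> R -> R -> R) : Prop :=
  (forall u v : R, u != 0 -> v != 0 -> loc_integrable t0 (fun t => F t u v)) /\
  (forall t : R, t0 <= t ->
     {within [set w : R * R | w.1 != 0 /\ w.2 != 0],
        continuous (fun w : R * R => F t w.1 w.2)}).

(* Nonvanishing of phi t and psi t is part of the system being satisfied at t:
   the coefficients are undefined otherwise. *)
Definition satisfies_system (R : realType) (P Q Rf S : R -> R -> R -> R)
    (phi psi : R -> R) (t : R) : Prop :=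
  [/\ phi t != 0, psi t != 0,
      is_derive t 1 phi (P t (phi t) (psi t) * phi t
                         + Q t (phi t) (psi t) * psi t) &
      is_derive t 1 psi (Rf t (phi t) (psi t) * phi t
                         + S t (phi t) (psi t) * psi t)].

Definition is_solution (R : realType) (P Q Rf S : R -> R -> R -> R)
    (t1 : R) (t2 : \bar R) (phi psi : R -> R) : Prop :=
  [/\ (t1%:E < t2)%E,
      loc_abs_continuous t1 t2 phi,
      loc_abs_continuous t1 t2 psi &
      {ae leb R, forall t : R, t1 <= t -> (t%:E < t2)%E ->
         satisfies_system P Q Rf S phi psi t}].

Definition max_existence_interval (R : realType)
    (P Q Rf S : R -> R -> R -> R) (t0 : R) (T : \bar R)
    (phi psi : R -> R) : Prop :=
  is_solution P Q Rf S t0 T phi psi /\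
  ~ exists (T' : \bar R) (phi' psi' : R -> R),
      [/\ (T < T')%E,
          is_solution P Q Rf S t0 T' phi' psi' &
          forall t : R, t0 <= t -> (t%:E < T)%E ->
            phi' t = phi t /\ psi' t = psi t].

Definition Kbound (R : realType) (t0 : R) (Pd Qd Rd B1d : R -> R)
    (t c1 c2 : R) : R :=
  c1 * expR (\int[leb R]_(s in `[t0, t]) Pd s
    + \int[leb R]_(tau in `[t0, t]) (Qd tau *
        (c2 / c1 * expR (- \int[leb R]_(s in `[t0, tau]) B1d s)
         + \int[leb R]_(zeta in `[t0, tau])
             (expR (- \int[leb R]_(s in `[zeta, tau]) B1d s) * Rd zeta)))).

Definition Lbound (R : realType) (t0 : R) (Sd Rd Qd B2d : R -> R)
    (t c1 c2 : R) : R :=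
  c2 * expR (\int[leb R]_(s in `[t0, t]) Sd s
    + \int[leb R]_(tau in `[t0, t]) (Rd tau *
        (c1 / c2 * expR (\int[leb R]_(s in `[t0, tau]) B2d s)
         + \int[leb R]_(zeta in `[t0, tau])
             (expR (\int[leb R]_(s in `[zeta, tau]) B2d s) * Qd zeta)))).

(* Main.v *)
Require Import Defs.
From HB Require Import structures.
From mathcomp Require Import all_boot all_order all_algebra.
From mathcomp Require Import all_classical all_reals all_analysis.
From mathcomp Require Import measurable_realfun ring lra.

Import Order.TTheory GRing.Theory Num.Theory.
Import numFieldNormedType.Exports.

Local Open Scope classical_set_scope.
Local Open Scope ring_scope.

(** Idea of the proof. While both components are positive, the ratio
    [x = psi / phi] satisfies [x' = R + S x - P x - Q x^2 <= Rd - B1d x]: the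
    quadratic term has a favourable sign because [Q >= 0], so [x] stays below
    the solution of a linear equation. Inserting this bound into
    [phi' / phi = P + Q x] and integrating gives exactly [phi <= K_delta]
    ([le_Kbound]). The bound [psi <= L_delta] is the same statement after
    exchanging the two components and replacing [B1d] by [- B2d] ([LboundE]).

    The hypotheses on the coefficients are only available where
    [delta <= phi <= K_delta + eps] and [delta <= psi <= L_delta + eps]. The
    upper restrictions take care of themselves: as long as they hold, the
    bounds [phi <= K_delta] and [psi <= L_delta] follow, and the margin [eps]
    lets a continuity argument proceed ([upper_bounds]). For the lower ones,
    [Q, R >= 0] gives [phi' >= alpha phi] and [psi' >= beta psi]. As [alpha] and
    [beta] do not depend on [delta], neither does the resulting positive floor,
    so [phi] and [psi] cannot reach zero ([solution_lower_bounds]).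

    Suppose now that the maximal interval ends at a finite [c]. The floor is
    bounded away from zero on [t0, c], hence a single [delta] serves the whole
    interval; there [phi] and [psi] are bounded, their derivatives are dominated
    by an integrable function, and they have limits at [c]. These limits lie in
    the interior of the region where the bounds hold, so the Cauchy problem
    restarts at [c] with a right-hand side clamped to a box
    ([caratheodory_existence]). Gluing contradicts maximality
    ([solution_continues]).

    The differential inequalities hold almost everywhere only. They integrate
    thanks to two facts: a function that is absolutely continuous and has a
    nonpositive derivative almost everywhere is nonincreasing
    ([ac_derive_le0]), and the indefinite integral of [f] is absolutely
    continuous with derivative [f] almost everywhere ([prim_ac],
    [prim_derive]). Together they give Gronwall's lemma ([gronwall]), from which
    all bounds are derived. *)

Section positive_solutions.
Set Implicit Arguments.
Unset Strict Implicit.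
Unset Printing Implicit Defensive.
Context {R : realType}.
Notation lam := (@lebesgue_measure R).
Notation cara := (caratheodory_type ((@wlength R idfun)^*)%mu).

(** * Completed and Borel Lebesgue measure *)

Lemma borel_leb_measurable (A : set (measurableTypeR R)) :
  measurable A -> measurable (A : set cara).
Proof. exact: sub_caratheodory. Qed.

(** The completed sigma-algebra adds to the Borel one only subsets of Borel null
    sets. This is what allows results on [lebesgue_measure] to be used for
    the completed measure. *)
Lemma leb_measurableP (E : set cara) : measurable E ->
  exists A N : set (measurableTypeR R),
    [/\ measurable A, measurable N, lam N = 0%E &
        forall x, ~ N x -> (E x <-> A x)].
Proof.
move=> mE.
have : (completed_algebra_gen lam).-sigma.-measurable E.
  by rewrite completed_caratheodory_measurable.
rewrite g_sigma_completed_algebra_genE => -[A mA [N0 [N [mN N00 N0N]]] <-].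
exists A, N; split=> // x Nx; split; last by left.
by case=> // /N0N.
Qed.

Lemma negligible_leb (A : set R) :
  (leb R).-negligible A -> lam.-negligible A.
Proof.
case=> B [mB B0 AB].
have [X [N [mX mN N0 BX]]] := leb_measurableP mB.
exists ((X `\` N) `|` N); split.
- by apply: measurableU => //; exact: measurableD.
- apply: null_set_setU => //; first exact: measurableD.
  apply/eqP; rewrite eq_le measure_ge0 andbT -[leRHS]B0.
  by apply: le_outer_measure => x [Xx Nx]; exact/BX.
- move=> x /AB Bx; have [Nx|Nx] := pselect (N x); first by right.
  by left; split => //; apply/BX.
Qed.

Lemma lam_negligible_leb (A : set R) :
  lam.-negligible A -> (leb R).-negligible A.
Proof.
case=> B [mB B0 AB]; exists B; split => //.
exact: borel_leb_measurable.
Qed.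

Lemma ae_leb_lam (Pr : set R) :
  {ae leb R, forall x, Pr x} -> {ae lam, forall x, Pr x}.
Proof. exact: negligible_leb. Qed.

Lemma ae_lam_leb (Pr : set R) :
  {ae lam, forall x, Pr x} -> {ae leb R, forall x, Pr x}.
Proof. exact: lam_negligible_leb. Qed.

Lemma measurable_leb_itv (i : interval R) : measurable ([set` i] : set cara).
Proof. by apply: borel_leb_measurable; exact: measurable_itv. Qed.

(** [lebesgue_measure] is the image of its completion under the identity, which
    is measurable from the larger sigma-algebra to the smaller one. *)
Lemma integral_leb_lam (D : set (measurableTypeR R)) (g : R -> \bar R) :
  measurable D -> measurable_fun [set: measurableTypeR R] g ->
  (leb R).-integrable D g ->
  lam.-integrable D g /\ (\int[leb R]_(x in D) g x = \int[lam]_(x in D) g x)%E.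
Proof.
move=> mD mg ig.
have mid : measurable_fun [set: cara] (idfun : cara -> measurableTypeR R).
  by move=> _ Y mY; rewrite setTI; exact: borel_leb_measurable.
split.
  have := @integrable_pushforward _ _ _ _ _ _ mid (leb R) D g mg ig mD.
  move=> /integrableP[mg' lg]; apply/integrableP; split => //.
by have := @integral_pushforward _ _ _ _ _ _ mid (leb R) D g mg ig mD.
Qed.

(** [f] is recovered from its rational sublevel sets, and each of them is a Borel
    set up to a Borel null set. There are countably many, so the exceptional
    sets together are null. *)
Lemma borel_representative (f : R -> R) :
  measurable_fun [set: cara] f ->
  exists g : R -> R, measurable_fun [set: measurableTypeR R] g /\
    {ae lam, forall x, f x = g x}.
Proof.
move=> mf.
have mE (q : rat) : measurable ([set x | f x < ratr q] : set cara).
  have := mf (@measurableT _ cara) `]-oo, (ratr q)[%classic (measurable_itv _).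
  by rewrite setTI (_ : f @^-1` _ = [set x | f x < ratr q]).
have /choice[X /choice[N XN]] : forall q : rat, exists A N : set (measurableTypeR R),
    [/\ measurable A, measurable N, lam N = 0%E &
        forall x, ~ N x -> (f x < ratr q <-> A x)].
  by move=> q; exact: leb_measurableP (mE q).
(* [f x] is the infimum of the rationals [q] with [f x < q] *)
pose gE x : \bar R := ereal_inf [set (ratr q)%:E | q in [set q | X q x]].
have mgE : measurable_fun [set: measurableTypeR R] gE.
  move=> mT; apply: (measurability _ (ErealGenCInfty.measurableE R)) => //.
  move=> _ [_ [y ->] <-]; rewrite setTI.
  rewrite (_ : _ @^-1` _ =
    ~` \bigcup_(q : rat) (if ratr q < y then X q else set0)).
    apply: measurableC; apply: bigcupT_measurable_rat => q.
    by case: ifPn => _ //; have [] := XN q.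
  apply/seteqP; split => x /=.
    rewrite in_itv/= andbT => yx [q _]; case: ifPn => // qy Xq.
    have : (gE x <= (ratr q)%:E)%E by apply: ereal_inf_lbound; exists q.
    by move=> /(le_trans yx); rewrite lee_fin leNgt qy.
  move=> h; rewrite in_itv/= andbT; apply: le_ereal_inf_tmp => _ [q /= Xq <-].
  rewrite lee_fin leNgt; apply/negP => qy; apply: h; exists q => //.
  by rewrite qy.
exists (fine \o gE); split; first exact: measurableT_comp.
pose M n := N (odflt 0 (unpickle n)).
have [K [mK K0 MK]] : lam.-negligible (\bigcup_n M n).
  apply: negligible_bigcup => n.
  by exists (M n); split=> //; rewrite /M; have [] := XN (odflt 0 (unpickle n)).
exists K; split=> //.
move=> x /= fx; apply: contrapT => Nx; apply: fx.
  have Xx q : f x < ratr q <-> X q x.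
    by have [_ _ _] := XN q; apply => Nq; apply: Nx; apply: MK;
      exists (pickle q) => //; rewrite /M pickleK.
  suff -> : gE x = (f x)%:E by [].
  apply/eqP; rewrite eq_le; apply/andP; split; last first.
    by apply: le_ereal_inf_tmp => _ [q /= /Xx fq <-]; rewrite lee_fin ltW.
  apply/lee_addgt0Pr => e e0.
  have /rat_in_itvoo[q] : f x < f x + e by rewrite ltrDl.
  rewrite in_itv/= => /andP[/Xx fq qe].
  apply: (@le_trans _ _ (ratr q)%:E); last by rewrite -EFinD lee_fin ltW.
  by apply: ereal_inf_lbound; exists q.
Qed.

(** * Primitives of locally integrable functions *)

Definition prim (t0 : R) (f : R -> R) (t : R) : R :=
  \int[leb R]_(s in `[t0, t]) f s.

Section primitive.
Implicit Types f g : R -> R.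

Lemma ae_imp (P Q : R -> Prop) :
  (forall x, P x -> Q x) -> {ae lam, forall x, P x} -> {ae lam, forall x, Q x}.
Proof. by apply: filterS; exact: (ae_filter_ringOfSetsType lam). Qed.

Lemma ae_imp2 (P Q S : R -> Prop) : (forall x, P x -> Q x -> S x) ->
  {ae lam, forall x, P x} -> {ae lam, forall x, Q x} -> {ae lam, forall x, S x}.
Proof. by apply: filterS2; exact: (ae_filter_ringOfSetsType lam). Qed.

Lemma loc_integrable_measurable t0 f : loc_integrable t0 f ->
  measurable_fun (`[t0, +oo[%classic : set cara) f.
Proof.
move=> intf.
have -> : `[t0, +oo[%classic = \bigcup_n `[t0, t0 + n%:R]%classic.
  apply/seteqP; split => x /=; rewrite in_itv/= ?andbT => tx.
    exists (Num.truncn (x - t0)).+1 => //=; rewrite in_itv/= tx/= -lerBlDl.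
    by rewrite ltW// truncnS_gt.
  by case: tx => n _ /=; rewrite in_itv/= => /andP[].
apply/measurable_fun_bigcup => i; first exact: measurable_leb_itv.
by have /measurable_int/measurable_EFinP := intf (t0 + i%:R).
Qed.

(** Cutting the Borel representative to [t0, +oo[ makes it locally integrable on
    the whole line, the setting of the Lebesgue differentiation theorem. *)
Lemma loc_integrable_borel t0 f : loc_integrable t0 f ->
  exists g, [/\ locally_integrable setT g,
    forall b, lam.-integrable `[t0, b] (EFin \o g),
    {ae lam, forall x, t0 <= x -> f x = g x} &
    forall t, prim t0 f t = \int[lam]_(s in `[t0, t]) g s].
Proof.
move=> intf; pose D : set R := `[t0, +oo[%classic.
have mf := loc_integrable_measurable intf.
have mD : measurable (D : set cara) by exact: measurable_leb_itv.
have mDR : measurable (D : set (measurableTypeR R)) by exact: measurable_itv.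
have /(measurable_restrictT _ mD) /borel_representative[g0 [mg0 fg0]] := mf.
pose g := g0 \_ D.
have mg : measurable_fun [set: measurableTypeR R] g.
  by apply/(measurable_restrictT _ mDR); exact: measurable_funTS.
have fg : {ae lam, forall x, t0 <= x -> f x = g x}.
  apply: ae_imp fg0 => x fx tx; move: fx.
  by rewrite /g !patchE mem_set//= /D/= in_itv/= tx.
have mgc b : measurable_fun (`[t0, b]%classic : set cara) g.
  move=> _ Y mY; apply: borel_leb_measurable.
  by have := measurable_funTS mg; apply.
have mfc b : measurable_fun (`[t0, b]%classic : set cara) f.
  by have /measurable_int/measurable_EFinP := intf b.
have fgb b : ae_eq (leb R) `[t0, b]%classic (EFin \o f) (EFin \o g).
  apply: ae_lam_leb; apply: ae_imp fg => x fx /=; rewrite in_itv/= => /andP[tx _].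
  by rewrite fx.
have ig b : (leb R).-integrable `[t0, b] (EFin \o g).
  have /integrableP[_ fin] := intf b; apply/integrableP; split.
    exact/measurable_EFinP.
  have <- : (\int[leb R]_(x in `[t0, b]) `|(EFin \o f) x| =
             \int[leb R]_(x in `[t0, b]) `|(EFin \o g) x|)%E.
    apply: ae_eq_integral.
    + exact: measurable_leb_itv.
    + by apply: measurableT_comp => //; exact/measurable_EFinP.
    + by apply: measurableT_comp => //; exact/measurable_EFinP.
    + exact: ae_eq_abse.
  exact: fin.
have mgE : measurable_fun [set: measurableTypeR R] (EFin \o g).
  exact/measurable_EFinP.
have igl b : lam.-integrable `[t0, b] (EFin \o g).
  by have [] := integral_leb_lam (@measurable_itv R `[t0, b]) mgE (ig b).
exists g; split => //.
- split => //; first exact: openT.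
  move=> K _ cK; have mK := compact_measurable cK.
  have [M [_ KM]] := compact_bounded cK.
  have : lam.-integrable K (EFin \o g).
    rewrite /g -restrict_EFin; apply/integrable_restrict => //.
    have ig0 : lam.-integrable `[t0, M + 1] (EFin \o g0).
      apply: eq_integrable (igl (M + 1)) => //.
      move=> x; rewrite inE/= in_itv/= => /andP[tx _].
      by rewrite /g patchE mem_set// /D/= in_itv/= tx.
    apply: (integrableS _ _ _ ig0); [exact: measurable_itv|exact: measurableI|].
    move=> x [Kx]; rewrite /D/= !in_itv/= andbT => ->/=.
    by apply: le_trans (ler_norm x) _; apply: (KM (M + 1)) => //; rewrite ltrDl.
  by case/integrableP.
- move=> t; rewrite /prim /Rintegral.
  have [_ <-] := integral_leb_lam (@measurable_itv R `[t0, t]) mgE (ig t).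
  congr fine; apply: ae_eq_integral.
  - exact: measurable_leb_itv.
  - exact/measurable_EFinP.
  - exact/measurable_EFinP.
  - exact: fgb.
Qed.

(** Lebesgue differentiation, transported along a Borel representative. *)
Lemma prim_derive t0 f : loc_integrable t0 f ->
  {ae lam, forall t, t0 < t -> is_derive t 1 (prim t0 f) (f t)}.
Proof.
move=> /loc_integrable_borel[g [locg ig fg fgE]].
have := @FTC1 R g (BLeft t0) ig locg; apply: (ae_imp2 _ fg) => t ft dt t0t.
rewrite ft ?ltW// (_ : prim t0 f = fun x => \int[lam]_(s in `[t0, x]) g s);
  last exact/funext.
have tt : (BLeft t0 < BRight t)%E by rewrite lte_fin.
have [dF <-] := dt tt.
by split; [exact: dF|exact: esym (derive1E _ _)].
Qed.

End primitive.

Section primitive_ac.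
Implicit Types f g : R -> R.

Lemma Rintegral_itv_oo (t0 : R) g x y :
  (forall b, lam.-integrable `[t0, b] (EFin \o g)) -> t0 <= x -> x <= y ->
  \int[lam]_(s in `[t0, y]) g s - \int[lam]_(s in `[t0, x]) g s =
  \int[lam]_(s in `]x, y[) g s.
Proof.
move=> ig tx xy; rewrite (@Rintegral_itvB _ g (BLeft t0) (BRight y) x) ?bnd_simp//.
rewrite -Rintegral_itv_bndo_bndc//.
apply: integrableS (ig y) => //.
move=> s /=; rewrite !in_itv/= => /andP[xs sy].
by rewrite (ltW sy) (le_trans tx (ltW xs)).
Qed.

(** [f] is, up to a small error in L1, a function bounded by a constant [C]; the
    integral of the error is small over any set, and that of the bounded part is
    at most [C] times the total length of the intervals. *)
Lemma prim_ac (t0 b : R) f : loc_integrable t0 f ->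
  abs_continuous t0 b (prim t0 f).
Proof.
move=> /loc_integrable_borel[g [_ ig _ fgE]] e e0.
pose E : set R := `[t0, b]%classic.
have mE : measurable (E : set (measurableTypeR R)) by exact: measurable_itv.
have Efin : (lam E < +oo)%E by rewrite lebesgue_measure_itv/=; case: ifPn => //;
  rewrite -EFinB ltry.
have [h_ [ch ih hcv]] := approximation_continuous_integrable mE Efin (ig b).
have e20 : 0 < e / 2 by rewrite divr_gt0.
have [h [hc hi hlt]] : exists h : R -> R, [/\ continuous h,
    lam.-integrable E (EFin \o h) &
    (\int[lam]_(z in E) `|(g z - h z)%:E| < (e / 2)%:E)%E].
  have /fine_cvgP[_ /cvgrPdist_lt/(_ _ e20)] := hcv.
  case=> N _ /(_ N (leqnn N)) /=; rewrite sub0r normrN => hN.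
  exists (h_ N); split => //; move: hN; rewrite ger0_norm; last first.
    by rewrite fine_ge0// integral_ge0.
  rewrite -lte_fin fineK//.
  apply: integrable_fin_num => //.
  have /integrable_abse := @integrableB _ _ _ _ _ mE _ _ (ig b) (ih N).
  by apply: eq_integrable.
have [C C0 hC] : exists2 C, 0 < C & forall z, E z -> `|h z| <= C.
  have [M [_ hM]] : bounded_set (h @` E).
    apply: compact_bounded; apply: continuous_compact.
      exact: continuous_subspaceT.
    exact: segment_compact.
  exists (`|M| + 1); first by rewrite ltr_wpDl.
  move=> z Ez; apply: (hM (`|M| + 1)); last by exists z.
  by rewrite (le_lt_trans (ler_norm _))// ltrDl.
exists (e / 2 / C) => [|n x y xy tr sd]; first by rewrite divr_gt0.
pose G z := `|(g z - h z)%:E|%E.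
have sub i : `]x i, y i[%classic `<=` E.
  have [tx xyi yb] := xy i; move=> z; rewrite /E/= !in_itv/= => /andP[xz zy].
  by rewrite (le_trans tx (ltW xz))/= (le_trans (ltW zy)).
have mG : measurable_fun E G.
  have := @integrableB _ _ _ _ _ mE _ _ (ig b) hi.
  move=> /integrable_abse/measurable_int.
  by apply: eq_measurable_fun.
have igi i : lam.-integrable `]x i, y i[ (EFin \o g).
  by apply: integrableS (ig b) => //; exact: sub.
have ihi i : lam.-integrable `]x i, y i[ (EFin \o h).
  by apply: integrableS hi => //; exact: sub.
have step i : (`|prim t0 f (y i) - prim t0 f (x i)|%:E <=
    \int[lam]_(z in `]x i, y i[) G z + (C * (y i - x i))%:E)%E.
  have [tx xyi yb] := xy i.
  rewrite !fgE Rintegral_itv_oo// EFin_normr_Rintegral//.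
  apply: (le_trans (le_abse_integral _ _ _)) => //.
    exact: measurable_int (igi i).
  have -> : (C * (y i - x i))%:E = (\int[lam]_(z in `]x i, y i[) C%:E)%E.
    rewrite integral_cst//= lebesgue_measure_itv/= lte_fin.
    move: xyi; rewrite le_eqVlt => /orP[/eqP ->|->]; last by rewrite EFinM EFinB.
    by rewrite ltxx subrr mulr0 mule0.
  have G0 z : `]x i, y i[%classic z -> (0 <= G z)%E by move=> _; exact: abse_ge0.
  rewrite -ge0_integralD//; last 2 first.
    exact: measurable_funS mG.
    by move=> z _; rewrite lee_fin ltW.
  apply: ge0_le_integral => //.
  - by apply: measurableT_comp => //; exact: measurable_int (igi i).
  - by apply: emeasurable_funD => //; exact: measurable_funS mG.
  - move=> z zi; rewrite -EFinD lee_fin.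
    have -> : g z = (g z - h z) + h z by rewrite subrK.
    rewrite (le_trans (ler_normD _ _))// subrK lerD2l.
    by apply: hC; exact: sub zi.
rewrite -lte_fin -sumEFin.
apply: (@le_lt_trans _ _ (\sum_(i < n) \int[lam]_(z in `]x i, y i[) G z +
    (C * \sum_(i < n) (y i - x i))%:E)%E).
  rewrite mulr_sumr -sumEFin -big_split/=.
  by apply: lee_sum => i _; exact: step.
have -> : e%:E = ((e / 2)%:E + (e / 2)%:E)%E by rewrite -EFinD -splitr.
apply: lte_leD => //; last first.
  by rewrite lee_fin mulrC -ler_pdivlMr// ltW.
apply: le_lt_trans hlt.
pose F i : set (measurableTypeR R) := `]x i, y i[%classic.
have DE : \big[setU/set0]_(i < n) F i `<=` E.
  by move=> z; rewrite -bigcup_seq => -[i _] /sub.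
apply: (@le_trans _ _ (\int[lam]_(z in \big[setU/set0]_(i < n) F i) G z)%E).
  rewrite ge0_integral_bigsetU//.
  - by move=> i; exact: measurable_itv.
  - exact: index_enum_uniq.
  - by apply: sub_trivIset tr.
  - exact: measurable_funS mG.
  - by move=> z _; exact: abse_ge0.
apply: ge0_subset_integral => //; last by move=> z _; exact: abse_ge0.
by apply: bigsetU_measurable => i _; exact: measurable_itv.
Qed.

End primitive_ac.

(** * Monotonicity of absolutely continuous functions *)

(** Induction along a segment: were the property to fail somewhere, the infimum
    of the points of failure would contradict the hypothesis. At [s = a] the
    premise is void, so this also covers the base case. *)
Lemma real_induction (a b : R) (Pr : R -> Prop) :
  (forall s, a <= s -> s <= b -> (forall t, a <= t -> t < s -> Pr t) ->
    exists2 r, 0 < r & forall t, s <= t -> t < s + r -> t <= b -> Pr t) ->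
  forall t, a <= t -> t <= b -> Pr t.
Proof.
move=> step t0 at0 t0b; apply: contrapT => nP.
pose B := [set t | [/\ a <= t, t <= b & ~ Pr t]].
have Bt0 : B t0 by split.
have B0 : B !=set0 by exists t0.
have lB : has_lbound B by exists a => t [].
pose s := inf B.
have as_ : a <= s by apply: lb_le_inf => // t [? _ _].
have sb : s <= b by apply: le_trans t0b; exact: ge_inf.
have [|r r0 hr] := step s as_ sb.
  move=> t at_ ts; apply: contrapT => nPt.
  have : s <= t by apply: ge_inf => //; split=> //; rewrite (le_trans (ltW ts)).
  by rewrite leNgt ts.
have hi : has_inf B by split.
have [t Bt tsr] := inf_adherent r0 hi.
have [_ tb nPt] := Bt.
by apply: nPt; apply: hr => //; exact: ge_inf.
Qed.

Definition disjoint_family (U : set R) (a t : R) n (x y : 'I_n -> R) :=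
  [/\ forall i, [/\ a <= x i, x i <= y i & y i <= t],
      trivIset [set: 'I_n] (fun i => `]x i, y i[%classic) &
      forall i, `]x i, y i[%classic `<=` U].

Lemma disjoint_family_cons (U : set R) (a t t' : R) n (x y : 'I_n -> R) :
  disjoint_family U a t x y -> a <= t -> t <= t' -> `]t, t'[%classic `<=` U ->
  disjoint_family U a t' (fun i => oapp x t (unlift ord0 i))
                         (fun i => oapp y t' (unlift ord0 i)).
Proof.
move=> [xy tr sub] at_ tt' tU; split.
- move=> i; case: unliftP => [j _|_] //=.
  by have [? ? yt] := xy j; split => //; exact: le_trans tt'.
- have dis j : `]x j, y j[%classic `&` `]t, t'[%classic = set0.
    rewrite -subset0 => z []/=; rewrite !in_itv/= => /andP[_ zy] /andP[tz _].
    have [_ _ yt] := xy j.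
    by have := lt_le_trans zy yt; rewrite ltNge (ltW tz).
  move/trivIsetP : tr => tr.
  apply/trivIsetP => i j _ _.
  case: unliftP => [i' ->|->]; case: unliftP => [j' ->|->] //=.
  + rewrite (inj_eq lift_inj) => ij; exact: tr.
  + by rewrite setIC.
- by move=> i; case: unliftP => [j _|_] /=; [exact: sub|exact: tU].
Qed.

Lemma disjoint_family_length (U : set R) (a t : R) n (x y : 'I_n -> R) :
  measurable (U : set (measurableTypeR R)) -> disjoint_family U a t x y ->
  ((\sum_(i < n) (y i - x i))%:E <= lam U)%E.
Proof.
move=> mU [xy tr sub].
have -> : (\sum_(i < n) (y i - x i))%:E = (\sum_(i < n) lam (`]x i,
  y i[%classic : set R))%E.
  rewrite -sumEFin; apply: eq_bigr => i _.
  rewrite lebesgue_measure_itv/= lte_fin.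
  have [_ + _] := xy i; rewrite le_eqVlt => /orP[/eqP ->|->]; last by rewrite EFinB.
  by rewrite ltxx subrr.
pose F i : set (measurableTypeR R) := `]x i, y i[%classic.
have mF i : measurable (F i) by exact: measurable_itv.
rewrite (_ : \sum_(i < n) _ = lam (\big[setU/set0]_(i < n) F i))%E; last first.
  by rewrite measure_bigsetU_ord.
apply: le_measure; rewrite ?inE//.
  exact: bigsetU_measurable.
by move=> z; rewrite -bigcup_seq => -[i _] /sub.
Qed.

(** Let [N] be the null set where the derivative is missing or positive, and [U]
    an open set of small measure containing it. Moving right from [a], a point
    outside [N] can be passed at the cost of an increase of [f] by at most [e1]
    times the distance, and a point of [N] at the cost of one more interval
    inside [U]. These intervals have small total length, so absolute continuity
    makes their contribution small. Real induction replaces the selection of a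
    fine tagged partition. *)
Lemma ac_derive_le0 (a b : R) (f : R -> R) : a <= b -> abs_continuous a b f ->
  {ae lam, forall t, a < t -> t < b ->
     exists2 l, is_derive t 1 f l & l <= 0} ->
  f b <= f a.
Proof.
move=> ab acf [N0 [mN0 N00 aeN0]].
apply/ler_addgt0Pr => e e0.
pose e1 := e / (b - a + 1).
have ba1 : 0 < b - a + 1 by rewrite ltr_wpDl// subr_ge0.
have e10 : 0 < e1 by rewrite divr_gt0.
have [d d0 hd] := acf _ e10.
(* the end points join the exceptional set: nothing is known about the
   derivative there *)
pose N := N0 `|` [set a; b].
have mab : measurable ([set a; b] : set (measurableTypeR R)).
  by apply: measurableU; exact: measurable_set1.
have mN : measurable (N : set (measurableTypeR R)) by exact: measurableU.
have Nz : lam N = 0%E.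
  apply: null_set_setU => //.
  by apply: null_set_setU => //; exact: lebesgue_measure_set1.
have Noo : (lam N < +oo)%E by rewrite Nz.
have [U [oU NU UN]] : exists U : set R, [/\ open U ,
  N `<=` U & (lam (U `\` N) < d%:E)%E].
  exact: lebesgue_regularity_outer.
have mU : measurable (U : set (measurableTypeR R)) by exact: open_measurable.
have Ud : (lam U < d%:E)%E.
  rewrite -(setDUK NU); apply: (@le_lt_trans _ _ (lam N + lam (U `\` N))%E).
    by apply: measureU2 => //; exact: measurableD.
  by rewrite Nz add0e.
pose good t := exists n (x y : 'I_n -> R), disjoint_family U a t x y /\
  f t - f a <= e1 * (t - a) + \sum_(i < n) `|f (y i) - f (x i)|.
suff [n [x [y [xyF fab]]]] : good b.
  have [xy tr sub] := xyF.
  have sd : \sum_(i < n) (y i - x i) < d.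
    by rewrite -lte_fin; apply: le_lt_trans Ud; exact: disjoint_family_length xyF.
  rewrite -lerBlDl; apply: (le_trans fab).
  have -> : e = e1 * (b - a) + e1.
    by rewrite -[X in _ + X]mulr1 -mulrDr divfK// gt_eqF.
  by rewrite lerD2l; apply: ltW; exact: hd.
have good0 : good a.
  exists 0, (fun=> 0), (fun=> 0); split.
    by split=> [[]//||[]//]; apply/trivIsetP => -[].
  by rewrite big_ord0 !subrr mulr0 addr0.
apply: (@real_induction a b good) => // s as_ sb hs.
(* it suffices to pass from a point just before [s] to any point just after *)
suff [r r0 hr] : exists2 r, 0 < r & forall t t', a <= t -> t <= s -> s <= t' ->
    t' <= b -> s - r < t -> t' < s + r -> good t -> good t'.
  exists r => // t' st' t'r t'b.
  have [sa|as1] := eqVneq s a.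
    by apply: (hr a) => //; rewrite sa ltrBlDr ltrDl.
  have {}as_ : a < s by rewrite lt_neqAle eq_sym as1.
  pose t := Num.max a (s - r / 2).
  have ts : t < s by rewrite /t gt_max as_/= ltrBlDr ltrDl divr_gt0.
  have at_ : a <= t by rewrite /t le_max lexx.
  apply: (hr t) => //; first exact: ltW; last exact: hs.
  rewrite /t lt_max; apply/orP; right.
  by rewrite ltrD2l ltrN2 gtr_pMr// invf_lt1// ltr1n.
have [Us|Us] := pselect (U s).
  have /nbhs_ballP[r /= r0 hr] : nbhs s U by exact: open_nbhs_nbhs.
  exists r => // t t' at_ ts st' t'b srt t'sr [n [x [y [xyF fta]]]].
  have tt' := le_trans ts st'.
  exists n.+1, (fun i => oapp x t (unlift ord0 i)), (fun i =>
    oapp y t' (unlift ord0 i)).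
  split.
    apply: disjoint_family_cons xyF _ _ _ => //.
    move=> z /=; rewrite in_itv/= => /andP[tz zt']; apply: hr.
    by rewrite /ball/= ltr_norml; lra.
  rewrite big_ord_recl unlift_none/=.
  under eq_bigr do rewrite liftK/=.
  have := ler_norm (f t' - f t).
  have : e1 * (t - a) <= e1 * (t' - a) by rewrite ler_pM2l// lerD2r.
  lra.
have nNs : ~ N s by move=> /NU.
have [as1 sb1] : a < s /\ s < b.
  split.
    rewrite lt_neqAle as_ andbT; apply/eqP => sa; apply: nNs; right; left; exact/esym.
  rewrite lt_neqAle sb andbT; apply/eqP => sa; apply: nNs; right; right; exact: sa.
have [l dl l0] : exists2 l, is_derive s 1 f l & l <= 0.
  by apply: contrapT => h; apply: nNs; left; apply: aeN0 => /= /(_ as1 sb1).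
have [r r0 hr] : exists2 r, 0 < r & forall h, `|h| < r ->
    `|f (s + h) - f s - l * h| <= e1 * `|h|.
  have : h^-1 *: ((f \o shift s) (h *: 1) - f s) @[h --> 0^'] --> l.
    have [df <-] := dl; exact: df.
  move=> /cvgrPdist_le/(_ _ e10)/nbhs_ballP[r /= r0 hr].
  exists r => // h hh; have [->|h0] := eqVneq h 0.
    by rewrite addr0 mulr0 !subrr normr0 mulr0.
  have := hr h; rewrite /ball/= sub0r normrN => /(_ hh h0).
  rewrite -(ler_pM2r (x := `|h|)) ?normr_gt0// -normrM mulrBl.
  rewrite /shift/= [h *: 1]mulr1 [_ *: _]mulrC -mulrA mulVf// mulr1 [h + s]addrC.
  by rewrite distrC.
exists r => // t t' at_ ts st' t'b srt t'sr [n [x [y [[xy tr sub] fta]]]].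
exists n, x, y; split.
  split=> // i; have [? ? yt] := xy i; split => //.
  exact: le_trans yt (le_trans ts st').
have h1 : f t' - f s <= e1 * (t' - s).
  have := hr (t' - s); rewrite subrKC ger0_norm ?subr_ge0// => hh.
  have /hh /ler_normlP[_] : t' - s < r by lra.
  have : l * (t' - s) <= 0 by rewrite mulr_le0_ge0// subr_ge0.
  lra.
have h2 : f s - f t <= e1 * (s - t).
  have := hr (t - s); rewrite subrKC distrC ger0_norm ?subr_ge0// => hh.
  have /hh /ler_normlP[+ _] : s - t < r by lra.
  have : 0 <= l * (t - s) by rewrite mulr_le0// subr_le0.
  lra.
apply: (@le_trans _ _ (e1 * (t' - s) + e1 * (s - t) + (f t - f a))); first lra.
have -> : e1 * (t' - s) + e1 * (s - t) = e1 * (t' - a) - e1 * (t - a) by ring.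
lra.
Qed.

(** * Calculus of absolutely continuous functions *)

Section ac_calculus.
Implicit Types (a b : R) (f g h : R -> R).

Lemma ac_sub a b a' b' f : abs_continuous a b f -> a <= a' -> b' <= b ->
  abs_continuous a' b' f.
Proof.
move=> acf aa' bb' e e0; have [d d0 hd] := acf e e0; exists d => // n x y xy.
apply: hd => i; have [ax xyi yb] := xy i.
by split=> //; [exact: le_trans ax|exact: le_trans bb'].
Qed.

(** Stability of absolute continuity under all the operations used below reduces
    to an estimate of increments by those of two absolutely continuous
    functions. *)
Lemma ac_lipschitz2 a b f g h (C : R) :
  abs_continuous a b f -> abs_continuous a b g ->
  (forall x y, a <= x -> x <= y -> y <= b ->
    `|h y - h x| <= C * (`|f y - f x| + `|g y - g x|)) ->
  abs_continuous a b h.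
Proof.
move=> acf acg lip e e0; pose D := `|C| + 1.
have D0 : 0 < D by rewrite ltr_wpDl.
have e20 : 0 < e / D / 2 by rewrite !divr_gt0.
have [d d0 hd] := acf _ e20; have [d' d'0 hd'] := acg _ e20.
exists (Num.min d d') => [|n x y xy tr]; first by rewrite lt_min d0.
rewrite lt_min => /andP[sd sd'].
have := hd _ _ _ xy tr sd; have := hd' _ _ _ xy tr sd'.
set F := \sum_(i < n) `|f _ - _|; set G := \sum_(i < n) `|g _ - _| => ltG ltF.
apply: (@le_lt_trans _ _ (D * (F + G))).
  rewrite /F /G -big_split/= mulr_sumr; apply: ler_sum => i _.
  have [ax xyi yb] := xy i; apply: (le_trans (lip _ _ ax xyi yb)).
  apply: ler_wpM2r; first by rewrite addr_ge0.
  by rewrite (le_trans (ler_norm C))// lerDl.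
by rewrite mulrC -ltr_pdivlMr// [ltRHS]splitr ltrD.
Qed.

Lemma ac_lipschitz a b f h (C : R) : abs_continuous a b f ->
  (forall x y, a <= x -> x <= y -> y <= b -> `|h y - h x| <= C * `|f y - f x|) ->
  abs_continuous a b h.
Proof.
move=> acf lip; apply: (@ac_lipschitz2 a b f f h (C / 2)) => // x y ax xy yb.
by rewrite (le_trans (lip _ _ ax xy yb))// le_eqVlt; apply/orP; left; apply/eqP; field.
Qed.

(** Families made of a single interval. *)
Lemma ac_unif_continuous a b f : abs_continuous a b f ->
  forall e, 0 < e -> exists2 d, 0 < d &
    forall x y, a <= x -> x <= b -> a <= y -> y <= b -> `|y - x| < d ->
      `|f y - f x| < e.
Proof.
move=> acf e e0; have [d d0 hd] := acf e e0; exists d => // x y.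
wlog xy : x y / x <= y => [wlg ax xb ay yb xyd|ax _ _ yb].
  have [xy|/ltW yx] := leP x y; first exact: wlg.
  by rewrite distrC; apply: wlg => //; rewrite distrC.
rewrite ger0_norm ?subr_ge0// => xyd.
have := hd 1%N (fun=> x) (fun=> y); rewrite !big_ord1; apply => //.
by apply/trivIsetP => i j _ _; rewrite (ord1 i) (ord1 j) eqxx.
Qed.

Lemma unif_continuous_within a b f :
  (forall e, 0 < e -> exists2 d, 0 < d &
    forall x y, a <= x -> x <= b -> a <= y -> y <= b -> `|y - x| < d ->
      `|f y - f x| < e) ->
  {within `[a, b], continuous f}.
Proof.
move=> ucf; apply/subspace_continuousP => x /=; rewrite in_itv/= => /andP[ax xb].
apply/cvgrPdist_lt => e e0; have [d d0 hd] := ucf e e0.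
rewrite near_withinE; apply/nbhs_ballP; exists d => // y /= xy.
rewrite in_itv/= => /andP[ay yb]; rewrite distrC; apply: hd => //.
by rewrite distrC.
Qed.

Lemma ac_continuous a b f : abs_continuous a b f ->
  {within `[a, b], continuous f}.
Proof. by move=> acf; apply/unif_continuous_within/ac_unif_continuous. Qed.

Lemma ac_bounded a b f : abs_continuous a b f ->
  exists2 M, 0 <= M & forall x, a <= x -> x <= b -> `|f x| <= M.
Proof.
move=> acf; have := ac_continuous acf => cf.
have [M [_ hM]] : bounded_set (f @` `[a, b]).
  by apply: compact_bounded; apply: continuous_compact => //; exact: segment_compact.
exists (`|M| + 1) => [|x ax xb]; first by rewrite addr_ge0.
apply: (hM (`|M| + 1)); last by exists x => //=; rewrite in_itv/= ax.
by rewrite (le_lt_trans (ler_norm _))// ltrDl.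
Qed.

Lemma acD a b f g : abs_continuous a b f -> abs_continuous a b g ->
  abs_continuous a b (fun t => f t + g t).
Proof.
move=> acf acg; apply: (ac_lipschitz2 (C := 1) acf acg) => x y _ _ _.
by rewrite mul1r opprD addrACA; exact: ler_normD.
Qed.

Lemma acN a b f : abs_continuous a b f -> abs_continuous a b (fun t => - f t).
Proof.
move=> acf; apply: (ac_lipschitz (C := 1) acf) => x y _ _ _.
by rewrite mul1r -opprD normrN.
Qed.

Lemma ac_cst a b (c : R) : abs_continuous a b (fun=> c).
Proof.
move=> e e0; exists 1 => // n x y _ _ _.
by rewrite big1// => i _; rewrite subrr normr0.
Qed.

Lemma acM a b f g : abs_continuous a b f -> abs_continuous a b g ->
  abs_continuous a b (fun t => f t * g t).
Proof.
move=> acf acg; have [M M0 hM] := ac_bounded acf; have [N N0 hN] := ac_bounded acg.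
apply: (ac_lipschitz2 (C := M + N) acf acg) => x y ax xy yb.
rewrite (_ : f y * g y - f x * g x = f y * (g y - g x) + (f y - f x) * g x);
  last by ring.
rewrite (le_trans (ler_normD _ _))// !normrM mulrDr addrC lerD//.
  rewrite mulrC ler_wpM2r// (le_trans (hN _ ax (le_trans xy yb)))// lerDr//.
by rewrite ler_wpM2r// (le_trans (hM _ (le_trans ax xy) yb))// lerDl.
Qed.

Lemma expR_lipschitz (M x y : R) : x <= M -> y <= M ->
  `|expR y - expR x| <= expR M * `|y - x|.
Proof.
wlog xy : x y / x <= y => [wlg xM yM|xM yM].
  have [xy|/ltW yx] := leP x y; first exact: wlg.
  by rewrite distrC [`|y - x|]distrC; exact: wlg.
rewrite !ger0_norm ?subr_ge0 ?ler_expR//.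
apply: (@le_trans _ _ (expR y * (y - x))); last first.
  by rewrite ler_wpM2r ?subr_ge0// ler_expR.
have -> : expR x = expR y * expR (x - y) by rewrite -expRD subrKC.
have := expR_ge1Dx (x - y); have := expR_gt0 y; nra.
Qed.

Lemma ac_expR a b f : abs_continuous a b f ->
  abs_continuous a b (fun t => expR (f t)).
Proof.
move=> acf; have [M M0 hM] := ac_bounded acf.
apply: (ac_lipschitz (C := expR M) acf) => x y ax xy yb.
by apply: expR_lipschitz; apply: le_trans (ler_norm _) _; apply: hM => //;
  [exact: le_trans yb|exact: le_trans xy].
Qed.

Lemma ac_inv a b f (d : R) : 0 < d -> abs_continuous a b f ->
  (forall t, a <= t -> t <= b -> d <= f t) ->
  abs_continuous a b (fun t => (f t)^-1).
Proof.
move=> d0 acf hd; apply: (ac_lipschitz (C := (d * d)^-1) acf) => x y ax xy yb.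
have fx := hd _ ax (le_trans xy yb); have fy := hd _ (le_trans ax xy) yb.
have fx0 := lt_le_trans d0 fx; have fy0 := lt_le_trans d0 fy.
rewrite (_ : _ - _ = (f x * f y)^-1 * (f x - f y)); last first.
  by field; rewrite !gt_eqF.
rewrite normrM distrC ler_wpM2r// ger0_norm ?invr_ge0 ?mulr_ge0 ?(ltW fx0) ?(ltW fy0)//.
by rewrite lef_pV2 ?posrE ?mulr_gt0// ler_pM// ltW.
Qed.

End ac_calculus.

(** * Linear differential inequalities *)

Section gronwall.
Implicit Types (a b : R) (f g h : R -> R).

Lemma prim_xx a f : loc_integrable a f -> prim a f a = 0.
Proof.
by move=> /loc_integrable_borel[g [_ _ _ ->]]; rewrite set_itv1 Rintegral_set1.
Qed.

Lemma prim_lt a f t : t < a -> prim a f t = 0.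
Proof.
by move=> ta; rewrite /prim set_itv_ge ?Rintegral_set0// bnd_simp -ltNge.
Qed.

Lemma eq_prim a f g t : (forall s, a <= s -> s <= t -> f s = g s) ->
  prim a f t = prim a g t.
Proof.
move=> fg; apply: eq_Rintegral => s; rewrite inE/= in_itv/= => /andP[sa st].
exact: fg.
Qed.

Lemma loc_integrableD a f g : loc_integrable a f -> loc_integrable a g ->
  loc_integrable a (fun t => f t + g t).
Proof.
move=> lf lg b; have mD : measurable (`[a,
  b]%classic : set cara) by exact: measurable_leb_itv.
by apply: eq_integrable (integrableD mD (lf b) (lg b)).
Qed.

Lemma loc_integrableN a f : loc_integrable a f -> loc_integrable a (fun t => - f t).
Proof.
move=> lf b; have mD : measurable (`[a,
  b]%classic : set cara) by exact: measurable_leb_itv.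
by apply: eq_integrable (integrableN (lf b)).
Qed.

Lemma loc_integrable_norm a f : loc_integrable a f -> loc_integrable a (fun t =>
  `|f t|).
Proof.
move=> lf b; have mD : measurable (`[a,
  b]%classic : set cara) by exact: measurable_leb_itv.
by apply: eq_integrable (integrable_abse (lf b)).
Qed.

Lemma continuous_leb_measurable a b h : {within `[a, b], continuous h} ->
  measurable_fun (`[a, b]%classic : set cara) h.
Proof.
move=> ch _ Y mY; apply: borel_leb_measurable.
have : measurable_fun (`[a, b]%classic : set (measurableTypeR R)) h.
  by apply: subspace_continuous_measurable_fun => //; exact: measurable_itv.
by apply => //; exact: measurable_itv.
Qed.

Lemma loc_integrableM a f h : (forall b, abs_continuous a b h) ->
  loc_integrable a f -> loc_integrable a (fun t => h t * f t).
Proof.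
move=> ch lf b.
have mD : measurable (`[a, b]%classic : set cara) by exact: measurable_leb_itv.
have [M M0 hM] := ac_bounded (ch b).
have := @integrableMr _ _ _ (leb R) _ mD h (EFin \o f).
move=> /(_ (continuous_leb_measurable (ac_continuous (ch b)))) H.
apply: eq_integrable (H _ (lf b)) => //.
exists M; split; first by rewrite num_real.
move=> N MN x; rewrite /= in_itv/= => /andP[ax xb].
by apply: le_trans (hM _ ax xb) (ltW MN).
Qed.

Lemma loc_integrableZ a f (c : R) : loc_integrable a f ->
  loc_integrable a (fun t => c * f t).
Proof. by apply: loc_integrableM => b; exact: ac_cst. Qed.

Lemma loc_integrable0 a : loc_integrable a (fun=> 0 : R).
Proof.
move=> b; have mD : measurable (`[a,
  b]%classic : set cara) by exact: measurable_leb_itv.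
exact: integrable0.
Qed.

Lemma prim0 a t : prim a (fun=> 0 : R) t = 0.
Proof. by rewrite /prim Rintegral_cst ?mul0r//; exact: measurable_leb_itv. Qed.

(** The integrating factor [exp (- prim al)] turns the inequality into the
    monotonicity of [v]. *)
Lemma gronwall a b (w al be : R -> R) : a <= b -> abs_continuous a b w ->
  loc_integrable a al -> loc_integrable a be ->
  {ae lam, forall t, a < t -> t < b ->
     exists2 l, is_derive t 1 w l & l <= al t * w t + be t} ->
  w b <= expR (prim a al b) *
         (w a + prim a (fun s => expR (- prim a al s) * be s) b).
Proof.
move=> ab acw lal lbe dw.
pose E s := expR (- prim a al s).
have acE c : abs_continuous a c E by apply/ac_expR/acN; exact: prim_ac.
have lG : loc_integrable a (fun s => E s * be s) by exact: loc_integrableM.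
pose v t := w t * E t - prim a (fun s => E s * be s) t.
have acv : abs_continuous a b v.
  by apply: acD; [exact: acM|apply: acN; exact: prim_ac].
have : v b <= v a.
  apply: ac_derive_le0 => //.
  apply: (ae_imp2 _ (ae_imp2 (fun t =>
    @conj _ _) dw (prim_derive lal)) (prim_derive lG)).
  move=> t [dwt dA] dG at_ tb; have [l dl ll] := dwt at_ tb.
  have {}dA := dA at_; have {}dG := dG at_.
  have dE : is_derive t 1 E (- al t * E t).
    have dN : is_derive t 1 (fun s => - prim a al s) (- al t) by apply: is_deriveN.
    by rewrite mulrC; exact: (is_derive1_comp (is_derive_expR _) dN).
  exists (E t * (l - al t * w t - be t)).
    rewrite /v; apply: is_derive_eq; rewrite /GRing.scale/=; ring.
  by rewrite mulr_ge0_le0// ?expR_ge0//; lra.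
have Ea : E a = 1 by rewrite /E prim_xx// oppr0 expR0.
rewrite /v Ea mulr1 prim_xx// subr0 lerBlDr => h.
have -> : w b = expR (prim a al b) * (w b * E b).
  by rewrite mulrCA -expRD subrr expR0 mulr1.
by rewrite ler_pM2l ?expR_gt0.
Qed.

End gronwall.

(** * The majorants K and L *)

Section upper_bound.
Implicit Types (a b : R) (f g h : R -> R).

Lemma loc_integrable_ge a x f : loc_integrable a f -> a <= x -> loc_integrable x f.
Proof.
move=> lf ax b; apply: integrableS (lf b); [exact: measurable_leb_itv..|].
by move=> s /=; rewrite !in_itv/= => /andP[/(le_trans ax) -> ->].
Qed.

Lemma primZ a f c t : loc_integrable a f -> prim a (fun s =>
  c * f s) t = c * prim a f t.
Proof. by move=> lf; rewrite /prim RintegralZl//; exact: measurable_leb_itv. Qed.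

Lemma primD a f g t : loc_integrable a f -> loc_integrable a g ->
  prim a (fun s => f s + g s) t = prim a f t + prim a g t.
Proof. by move=> lf lg; rewrite /prim RintegralD//; exact: measurable_leb_itv. Qed.

Lemma primN a f t : loc_integrable a f -> prim a (fun s => - f s) t = - prim a f t.
Proof.
move=> lf; rewrite -mulN1r -primZ//; apply: eq_prim => s _ _.
by rewrite mulN1r.
Qed.

Lemma ac_le_prim a b w f : a <= b -> abs_continuous a b w -> loc_integrable a f ->
  {ae lam, forall t, a < t -> t < b ->
     exists2 l, is_derive t 1 w l & l <= f t} ->
  w b - w a <= prim a f b.
Proof.
move=> ab acw lf dw.
have := gronwall ab acw (loc_integrable0 a) lf.
rewrite prim0 expR0 mul1r lerBlDl => H; apply: (le_trans (H _)).
  apply: ae_imp dw => t dw at_ tb; have [l dl ll] := dw at_ tb.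
  by exists l => //; rewrite mul0r add0r.
by rewrite lerD2l le_eqVlt; apply/orP; left; apply/eqP/eq_prim => s _ _;
  rewrite prim0 oppr0 expR0 mul1r.
Qed.

(** An absolutely continuous function is determined by its derivative up to a
    constant. Additivity of the integral over adjacent intervals ([prim_sub]) is
    deduced from this. *)
Lemma ac_eq_prim a b w f : a <= b -> abs_continuous a b w -> loc_integrable a f ->
  {ae lam, forall t, a < t -> t < b -> is_derive t 1 w (f t)} ->
  w b - w a = prim a f b.
Proof.
move=> ab acw lf dw; apply/eqP; rewrite eq_le; apply/andP; split.
  by apply: ac_le_prim => //; apply: ae_imp dw => t dw at_ tb; exists (f t) => //;
    exact: dw.
rewrite -lerN2 -primN// opprB -[w a]opprK addrC.
apply: (ac_le_prim (w := fun t => - w t)) => //; [exact: acN|exact: loc_integrableN|].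
apply: ae_imp dw => t dw at_ tb; exists (- f t) => //.
by apply: is_deriveN; exact: dw.
Qed.

Lemma prim_sub a x y f : loc_integrable a f -> a <= x -> x <= y ->
  prim x f y = prim a f y - prim a f x.
Proof.
move=> lf ax xy; apply/esym; apply: ac_eq_prim => //.
- by apply: ac_sub (prim_ac _ lf) ax (lexx y).
- exact: loc_integrable_ge lf ax.
- apply: ae_imp (prim_derive lf) => t dt xt _; apply: dt.
  exact: le_lt_trans xt.
Qed.

(** Variation of constants for [w' = al w + be], [w a = c]. *)
Definition linear_solution (a : R) (al be : R -> R) (c t : R) : R :=
  expR (prim a al t) * (c + prim a (fun s => expR (- prim a al s) * be s) t).

Lemma loc_integrable_linear a al be : loc_integrable a al -> loc_integrable a be ->
  loc_integrable a (fun s => expR (- prim a al s) * be s).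
Proof.
move=> lal lbe; apply: loc_integrableM => // b.
by apply/ac_expR/acN; exact: prim_ac.
Qed.

Lemma linear_solution_ac a al be c b : loc_integrable a al -> loc_integrable a be ->
  abs_continuous a b (linear_solution a al be c).
Proof.
move=> lal lbe; apply: acM; first by apply: ac_expR; exact: prim_ac.
by apply: acD; [exact: ac_cst|exact/prim_ac/loc_integrable_linear].
Qed.

(** The bracket in [K] is the solution of [x' = - B1d x + Rd] starting from
    [c2 / c1], so [K] is the solution of [w' = (Pd + Qd x) w] starting from
    [c1]. *)
Lemma KboundE (t0 : R) (Pd Qd Rd B1d : R -> R) (c1 c2 t : R) :
  loc_integrable t0 Pd -> loc_integrable t0 Qd -> loc_integrable t0 Rd ->
  loc_integrable t0 B1d ->
  Kbound t0 Pd Qd Rd B1d t c1 c2 =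
  c1 * expR (prim t0 (fun s => Pd s +
     linear_solution t0 (fun s => - B1d s) Rd (c2 / c1) s * Qd s) t).
Proof.
move=> lP lQ lR lB; have lN := loc_integrableN lB.
have lL : loc_integrable t0 (fun s => linear_solution t0 (fun s =>
  - B1d s) Rd (c2 / c1) s * Qd s).
  by apply: loc_integrableM => // b; exact: linear_solution_ac.
(* The congruences are stated for abstract reals, so that no two integrals
   are compared by unfolding them. *)
have cgK (x y y' : R) : y = y' -> c1 * expR (x + y) = c1 * expR (x + y').
  by move=> ->.
have cgz (q e e' v v' c : R) : e = e' -> v = e' * v' ->
    q * (c * e + v) = e' * (c + v') * q.
  by move=> -> ->; ring.
have cge (u u' v r : R) : u = u' * v -> u * r = u' * (v * r).
  by move=> ->; rewrite mulrA.
rewrite (primD t lP lL) /Kbound; apply: cgK.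
rewrite /prim; apply: eq_Rintegral => s _; apply: cgz.
  by rewrite -[X in expR (- X)]/(prim t0 B1d s) -[X in _ = expR X]/(prim t0 (fun s => - B1d s) s) (primN s lB).
rewrite -(primZ _ s (loc_integrable_linear lN lR)).
rewrite /prim; apply: eq_Rintegral => z; rewrite inE/= in_itv/= => /andP[tz zs].
apply: cge; rewrite -[X in expR (- X) = _]/(prim z B1d s) (prim_sub lB tz zs).
rewrite -[X in _ = X * _]/(expR (prim t0 (fun s => - B1d s) s)).
rewrite -[X in _ = _ * X]/(expR (- prim t0 (fun s => - B1d s) z)).
by rewrite (primN s lB) (primN z lB) opprK -expRD opprB addrC.
Qed.

Lemma Kbound_ac (t0 : R) (Pd Qd Rd B1d : R -> R) (c1 c2 b : R) :
  loc_integrable t0 Pd -> loc_integrable t0 Qd -> loc_integrable t0 Rd ->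
  loc_integrable t0 B1d ->
  abs_continuous t0 b (fun t => Kbound t0 Pd Qd Rd B1d t c1 c2).
Proof.
move=> lP lQ lR lB.
rewrite (_ : (fun t => _) = fun t => c1 * expR (prim t0 (fun s => Pd s +
     linear_solution t0 (fun s => - B1d s) Rd (c2 / c1) s * Qd s) t)); last first.
  by apply/funext => t; exact: KboundE.
apply: acM; first exact: ac_cst.
apply/ac_expR/prim_ac/loc_integrableD => //.
by apply: loc_integrableM => // b'; apply: linear_solution_ac => //;
  exact: loc_integrableN.
Qed.

(** Exchanging the components of the system turns [S - P >= - B2d] into the
    hypothesis on [B1d]; thus every property of [L] follows from one of [K]. *)
Lemma LboundE (t0 : R) (Sd Rd Qd B2d : R -> R) (c1 c2 t : R) :
  loc_integrable t0 B2d ->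
  Lbound t0 Sd Rd Qd B2d t c1 c2 = Kbound t0 Sd Rd Qd (fun s => - B2d s) t c2 c1.
Proof.
move=> lB.
have cgK (x y y' : R) : y = y' -> c2 * expR (x + y) = c2 * expR (x + y').
  by move=> ->.
have cgz (q e e' v v' c : R) : e = e' -> v = v' ->
    q * (c * expR e + v) = q * (c * expR e' + v').
  by move=> -> ->.
have cge (u u' r : R) : u = u' -> expR u * r = expR u' * r by move=> ->.
have NN z s : t0 <= z -> \int[leb R]_(x in `[z, s]) B2d x =
    - \int[leb R]_(x in `[z, s]) (- B2d x).
  move=> tz; rewrite -[X in _ = - X]/(prim z (fun x => - B2d x) s).
  by rewrite (primN s (loc_integrable_ge lB tz)) opprK.
rewrite /Lbound /Kbound; apply: cgK.
apply: eq_Rintegral => s _; apply: cgz; first exact: NN.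
apply: eq_Rintegral => z; rewrite inE/= in_itv/= => /andP[tz zs].
by apply: cge; exact: NN.
Qed.

(** Two applications of Gronwall's lemma: to the ratio [psi / phi], whose Riccati
    equation loses its quadratic term, and then to [phi]. The positive lower
    bound [d] makes the ratio absolutely continuous. *)
Lemma le_Kbound (t0 b d : R) (Pd Qd Rd B1d phi psi : R -> R) :
  t0 <= b -> 0 < d ->
  loc_integrable t0 Pd -> loc_integrable t0 Qd -> loc_integrable t0 Rd ->
  loc_integrable t0 B1d ->
  abs_continuous t0 b phi -> abs_continuous t0 b psi ->
  (forall t, t0 <= t -> t <= b -> d <= phi t /\ d <= psi t) ->
  {ae lam, forall t, t0 < t -> t < b -> exists p q r s,
    [/\ is_derive t 1 phi (p * phi t + q * psi t),
        is_derive t 1 psi (r * phi t + s * psi t) &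
        [/\ p <= Pd t, 0 <= q <= Qd t, 0 <= r <= Rd t & B1d t <= p - s]]} ->
  phi b <= Kbound t0 Pd Qd Rd B1d b (phi t0) (psi t0).
Proof.
move=> t0b d0 lP lQ lR lB acphi acpsi hd sys.
have lN := loc_integrableN lB.
set z := linear_solution t0 (fun s => - B1d s) Rd (psi t0 / phi t0).
have ratio t : t0 <= t -> t <= b -> psi t / phi t <= z t.
  move=> t0t tb; apply: (gronwall (w := fun t => psi t / phi t)) => //.
    apply: ac_sub (lexx t0) tb; apply: acM => //.
    by apply: (ac_inv d0) => // s ts sb; have [] := hd s ts sb.
  apply: ae_imp sys => s sys ts st.
  have sb := lt_le_trans st tb.
  have [p [q [r [s' [dphi dpsi [pP /andP[q0 qQ] /andP[r0 rR] Bps]]]]]] := sys ts sb.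
  have [ph ps] := hd s (ltW ts) (ltW sb).
  have phi0 := lt_le_trans d0 ph; have psi0 := lt_le_trans d0 ps.
  have phiN : phi s != 0 by rewrite gt_eqF.
  exists (r + s' * (psi s / phi s) - p * (psi s / phi s) - q * (psi s / phi s) ^+ 2).
    have dV := is_deriveV phiN dphi.
    apply: (is_derive_eq (is_deriveM dpsi dV)).
    by rewrite /GRing.scale/=; field.
  have x0 : 0 < psi s / phi s by rewrite divr_gt0.
  have : 0 <= q * (psi s / phi s) ^+ 2 by rewrite mulr_ge0// exprn_ge0// ltW.
  move: x0; set x := psi s / phi s => x0 qx.
  have : 0 <= (p - s' - B1d s) * x by rewrite mulr_ge0 ?subr_ge0// ltW.
  lra.
have lL : loc_integrable t0 (fun s => z s * Qd s).
  by apply: loc_integrableM => // b'; exact: linear_solution_ac.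
rewrite KboundE// -/z.
have := @gronwall t0 b phi (fun s => Pd s + z s * Qd s) (fun=> 0) t0b acphi.
move=> /(_ (loc_integrableD lP lL) (loc_integrable0 t0)) H.
apply: (le_trans (H _)); last first.
  rewrite [X in _ + X](_ : _ = 0) ?addr0 1?mulrC//.
  by rewrite -[RHS](prim0 t0 b); apply: eq_prim => s _ _; rewrite mulr0.
apply: ae_imp sys => s sys ts sb.
have [p [q [r [s' [dphi dpsi [pP /andP[q0 qQ] /andP[r0 rR] Bps]]]]]] := sys ts sb.
have [ph ps] := hd s (ltW ts) (ltW sb).
have phi0 := lt_le_trans d0 ph; have psi0 := lt_le_trans d0 ps.
exists (p * phi s + q * psi s) => //; rewrite addr0.
have -> : p * phi s + q * psi s = (p + psi s / phi s * q) * phi s.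
  by field; rewrite gt_eqF.
rewrite ler_pM2r// lerD// ler_pM//; first by rewrite ltW// divr_gt0.
by apply: ratio; exact: ltW.
Qed.

End upper_bound.

(** * A priori bounds along a solution *)

Section a_priori_bounds.
Implicit Types (a b : R) (f g h : R -> R).

Lemma ac_ge0_left a b w s : abs_continuous a b w -> a < s -> s <= b ->
  (forall t, a <= t -> t < s -> 0 <= w t) -> 0 <= w s.
Proof.
move=> acw as_ sb hw; rewrite leNgt; apply/negP => ws0.
have e0 : 0 < - w s by rewrite oppr_gt0.
have [d d0 hd] := ac_unif_continuous acw e0.
pose t := Num.max a (s - d / 2).
have ts : t < s by rewrite /t gt_max as_/= ltrBlDr ltrDl divr_gt0.
have at_ : a <= t by rewrite /t le_max lexx.
have st : s - t < d.
  have : s - d / 2 <= t by rewrite /t le_max lexx orbT.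
  lra.
have := hd s t (ltW as_) sb at_ (le_trans (ltW ts) sb).
rewrite distrC ger0_norm ?subr_ge0 ?ltW// => /(_ st).
have := hw t at_ ts; have := ler_norm (w t - w s); lra.
Qed.

Lemma ac_gt0_right a b w s : abs_continuous a b w -> a <= s -> s <= b -> 0 < w s ->
  exists2 r, 0 < r & forall t, s <= t -> t < s + r -> t <= b -> 0 < w t.
Proof.
move=> acw as_ sb ws0; have [d d0 hd] := ac_unif_continuous acw ws0.
exists d => // t st tsd tb.
have := hd s t as_ sb (le_trans as_ st) tb.
rewrite ger0_norm ?subr_ge0// => /(_ _)/ltr_normlP[|]; lra.
Qed.

Lemma ac_gt0_min a b w : a <= b -> abs_continuous a b w ->
  (forall t, a <= t -> t <= b -> 0 < w t) ->
  exists2 d, 0 < d & forall t, a <= t -> t <= b -> d <= w t.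
Proof.
move=> ab acw w0; have [c /=] := EVT_min ab (ac_continuous acw).
rewrite in_itv/= => /andP[ac cb] hc; exists (w c); first exact: w0.
by move=> t at_ tb; apply: hc; rewrite in_itv/= at_.
Qed.

Context (t0 : R) (P Q Rf S : R -> R -> R -> R) (alpha beta : R -> R)
  (Pd Qd Rd Sd B1d B2d : R -> R -> R)
  (halpha : loc_integrable t0 alpha) (hbeta : loc_integrable t0 beta)
  (hd : forall delta : R, 0 < delta ->
     [/\ loc_integrable t0 (Pd delta), loc_integrable t0 (Qd delta) &
         loc_integrable t0 (Rd delta)] /\
     [/\ loc_integrable t0 (Sd delta), loc_integrable t0 (B1d delta) &
         loc_integrable t0 (B2d delta)])
  (c1 c2 eps : R) (hc1 : 0 < c1) (hc2 : 0 < c2) (heps : 0 < eps).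
Let K d t := Kbound t0 (Pd d) (Qd d) (Rd d) (B1d d) t c1 c2.
Let L d t := Lbound t0 (Sd d) (Rd d) (Qd d) (B2d d) t c1 c2.
Context (hbounds : forall delta t u v : R,
     0 < delta -> delta < eps -> t0 <= t ->
     delta <= u -> u <= K delta t + eps ->
     delta <= v -> v <= L delta t + eps ->
     [/\ alpha t <= P t u v <= Pd delta t,
         beta t <= S t u v <= Sd delta t,
         0 <= Q t u v <= Qd delta t,
         0 <= Rf t u v <= Rd delta t &
         B1d delta t <= P t u v - S t u v <= B2d delta t]).

Lemma K_ac d b : 0 < d -> abs_continuous t0 b (K d).
Proof. by move=> /hd[[? ? ?] [? ? ?]]; exact: Kbound_ac. Qed.

Lemma L_ac d b : 0 < d -> abs_continuous t0 b (L d).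
Proof.
move=> /hd[[? ? ?] [? ? ?]]; rewrite /L.
rewrite (_ : (fun t => _) = fun t => Kbound t0 (Sd d) (Rd d) (Qd d) (fun s =>
  - B2d d s) t c2 c1).
  by apply: Kbound_ac => //; exact: loc_integrableN.
by apply/funext => t; exact: LboundE.
Qed.

Section along_solution.
Context (phi psi : R -> R) (b : R) (t0b : t0 <= b)
  (acphi : abs_continuous t0 b phi) (acpsi : abs_continuous t0 b psi)
  (phi0 : phi t0 = c1) (psi0 : psi t0 = c2)
  (sys : {ae lam, forall t, t0 < t -> t < b -> satisfies_system P Q Rf S phi psi t}).

(** The weak bounds before [s] put the solution in the region where the
    coefficients are controlled, and there [le_Kbound] removes the [eps]. *)
Lemma upper_bounds_step d s : 0 < d -> d < eps -> t0 <= s -> s <= b ->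
  (forall t, t0 <= t -> t <= s -> d <= phi t /\ d <= psi t) ->
  (forall t, t0 <= t -> t < s -> phi t <= K d t + eps /\ psi t <= L d t + eps) ->
  phi s <= K d s /\ psi s <= L d s.
Proof.
move=> d0 de ts sb hge hle; have [[lP lQ lR] [lS lB1 lB2]] := hd d0.
have acphis := ac_sub acphi (lexx t0) sb; have acpsis := ac_sub acpsi (lexx t0) sb.
split.
  rewrite /K -phi0 -psi0; apply: (le_Kbound (d := d)) => //.
  apply: ae_imp sys => t syst tt ts'.
  have [_ _ dphi dpsi] := syst tt (lt_le_trans ts' sb).
  exists (P t (phi t) (psi t)), (Q t (phi t) (psi t)), (Rf t (phi t) (psi t)),
    (S t (phi t) (psi t)).
  split=> //; have [g1 g2] := hge t (ltW tt) (ltW ts').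
  have [l1 l2] := hle t (ltW tt) ts'.
  by have [/andP[_ ?] _ ? ? /andP[? _]] := hbounds d0 de (ltW tt) g1 l1 g2 l2.
rewrite /L LboundE// -phi0 -psi0; apply: (le_Kbound (d := d)) => //.
- exact: loc_integrableN.
- by move=> t tt ts'; have [] := hge t tt ts'.
apply: ae_imp sys => t syst tt ts'.
have [_ _ dphi dpsi] := syst tt (lt_le_trans ts' sb).
exists (S t (phi t) (psi t)), (Rf t (phi t) (psi t)), (Q t (phi t) (psi t)),
  (P t (phi t) (psi t)).
split; [by rewrite addrC|by rewrite addrC|].
have [g1 g2] := hge t (ltW tt) (ltW ts').
have [l1 l2] := hle t (ltW tt) ts'.
have [_ /andP[_ ?] ? ? /andP[_ ?]] := hbounds d0 de (ltW tt) g1 l1 g2 l2.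
by split => //; rewrite -opprB lerN2.
Qed.

(** The gain from [K + eps] to [K] at [s] leaves room to continue the weak bounds
    past [s]. *)
Lemma upper_bounds d : 0 < d -> d < eps ->
  (forall t, t0 <= t -> t <= b -> d <= phi t /\ d <= psi t) ->
  forall t, t0 <= t -> t <= b -> phi t <= K d t /\ psi t <= L d t.
Proof.
move=> d0 de hge.
have main : forall t, t0 <= t -> t <= b -> phi t <= K d t + eps /\ psi t <= L d t + eps.
  apply: real_induction => s ts sb hs.
  have [hK hL] : phi s <= K d s /\ psi s <= L d s.
    apply: upper_bounds_step => // t tt ts'.
    by apply: hge => //; exact: le_trans sb.
  have aK := acD (acD (K_ac b d0) (ac_cst t0 b eps)) (acN acphi).
  have aL := acD (acD (L_ac b d0) (ac_cst t0 b eps)) (acN acpsi).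
  have [|r r0 hr] := ac_gt0_right aK ts sb.
    by rewrite subr_gt0; apply: le_lt_trans hK _; rewrite ltrDl.
  have [|r' r'0 hr'] := ac_gt0_right aL ts sb.
    by rewrite subr_gt0; apply: le_lt_trans hL _; rewrite ltrDl.
  exists (Num.min r r') => [|t st]; first by rewrite lt_min r0.
  rewrite -ltrBlDl lt_min ltrBlDl => /andP[tr]; rewrite ltrBlDl => tr' tb.
  by split; apply: ltW; rewrite -subr_gt0; [exact: hr|exact: hr'].
move=> t tt tb; apply: upper_bounds_step => // s ts st.
  by apply: hge => //; exact: le_trans tb.
by apply: main => //; exact: le_trans (ltW st) tb.
Qed.

Lemma coefficient_bounds d : 0 < d -> d < eps ->
  (forall t, t0 <= t -> t <= b -> d <= phi t /\ d <= psi t) ->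
  forall t, t0 <= t -> t <= b -> 
     [/\ alpha t <= P t (phi t) (psi t) <= Pd d t,
         beta t <= S t (phi t) (psi t) <= Sd d t,
         0 <= Q t (phi t) (psi t) <= Qd d t,
         0 <= Rf t (phi t) (psi t) <= Rd d t &
         B1d d t <= P t (phi t) (psi t) - S t (phi t) (psi t) <= B2d d t].
Proof.
move=> d0 de hge t tt tb; have [g1 g2] := hge t tt tb.
have [l1 l2] := upper_bounds d0 de hge tt tb.
have up x : x <= x + eps by rewrite lerDl ltW.
by apply: hbounds => //; [exact: le_trans l1 (up _)|exact: le_trans l2 (up _)].
Qed.

(** Positivity on the compact interval provides some [d] for which the
    coefficients are controlled; [d] disappears from the conclusion because
    [alpha] and [beta] do not depend on it. *)
Lemma lower_bounds : (forall t, t0 <= t -> t <= b -> 0 < phi t /\ 0 < psi t) ->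
  c1 * expR (prim t0 alpha b) <= phi b /\ c2 * expR (prim t0 beta b) <= psi b.
Proof.
move=> pos.
have [d1 d10 hd1] := ac_gt0_min t0b acphi (fun t tt tb => (pos t tt tb).1).
have [d2 d20 hd2] := ac_gt0_min t0b acpsi (fun t tt tb => (pos t tt tb).2).
pose d := Num.min (Num.min d1 d2) (eps / 2).
have d0 : 0 < d by rewrite !lt_min d10 d20 divr_gt0.
have de : d < eps by rewrite gt_min; apply/orP; right;
  rewrite gtr_pMr// invf_lt1// ltr1n.
have hge t : t0 <= t -> t <= b -> d <= phi t /\ d <= psi t.
  by move=> tt tb; rewrite !ge_min hd1// hd2// orbT.
have cb := coefficient_bounds d0 de hge.
(* Gronwall's lemma for [- w] *)
have decay (c : R) (w al : R -> R) (v : R) : 0 < c -> loc_integrable t0 al ->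
  abs_continuous t0 b w -> w t0 = c ->
    {ae lam, forall t, t0 < t -> t < b ->
      exists2 l, is_derive t 1 w l & al t * w t <= l} -> v = w b ->
    c * expR (prim t0 al b) <= v.
  move=> c0 la acw w0 dw ->.
  have := gronwall t0b (acN acw) la (loc_integrable0 t0).
  rewrite (_ : prim t0 (fun s => expR (- prim t0 al s) * 0) b = 0); last first.
    by rewrite -[RHS](prim0 t0 b); apply: eq_prim => s _ _; rewrite mulr0.
  rewrite addr0 mulrN lerN2 w0 mulrC; apply.
  apply: ae_imp dw => t dw tt tb; have [l dl ll] := dw tt tb.
  exists (- l); first exact: is_deriveN.
  by rewrite addr0 mulrN lerN2.
split.
  apply: (decay _ phi) => //.
  apply: ae_imp sys => t syst tt tb; have [_ _ dphi _] := syst tt tb; eexists;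
    first exact: dphi.
  have [/andP[aP _] _ /andP[Q0 _] _ _] := cb t (ltW tt) (ltW tb).
  have [p1 p2] := pos t (ltW tt) (ltW tb).
  by rewrite -[leLHS]addr0 lerD// ?mulr_ge0 ?(ltW p2)// ler_pM2r.
apply: (decay _ psi) => //.
apply: ae_imp sys => t syst tt tb; have [_ _ _ dpsi] := syst tt tb; eexists;
  first exact: dpsi.
have [_ /andP[bS _] _ /andP[R0 _] _] := cb t (ltW tt) (ltW tb).
have [p1 p2] := pos t (ltW tt) (ltW tb).
by rewrite -[leLHS]add0r lerD// ?mulr_ge0 ?(ltW p1)// ler_pM2r.
Qed.

End along_solution.

(** The bounds before [s] extend to [s] by continuity, so the solution is still
    positive at [s] and shortly after; [lower_bounds] then applies on the longer
    interval. *)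
Lemma solution_lower_bounds (phi psi : R -> R) (b : R) : t0 <= b ->
  abs_continuous t0 b phi -> abs_continuous t0 b psi ->
  phi t0 = c1 -> psi t0 = c2 ->
  {ae lam, forall t, t0 < t -> t < b -> satisfies_system P Q Rf S phi psi t} ->
  forall t, t0 <= t -> t <= b ->
    c1 * expR (prim t0 alpha t) <= phi t /\ c2 * expR (prim t0 beta t) <= psi t.
Proof.
move=> t0b acphi acpsi phi0 psi0 sys.
have acA : abs_continuous t0 b (fun t => phi t - c1 * expR (prim t0 alpha t)).
  by apply: acD => //; apply/acN/acM; [exact: ac_cst|exact/ac_expR/prim_ac].
have acB : abs_continuous t0 b (fun t => psi t - c2 * expR (prim t0 beta t)).
  by apply: acD => //; apply/acN/acM; [exact: ac_cst|exact/ac_expR/prim_ac].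
have pos0 (c : R) (al : R -> R) t : 0 < c -> 0 < c * expR (prim t0 al t).
  by move=> c0; rewrite mulr_gt0// expR_gt0.
apply: real_induction => s ts sb hs.
have [sA sB]
  : c1 * expR (prim t0 alpha s) <= phi s /\ c2 * expR (prim t0 beta s) <= psi s.
  have [ts0|ts0] := eqVneq t0 s.
    by rewrite -ts0 !prim_xx// expR0 !mulr1 phi0 psi0.
  have {}ts0 : t0 < s by rewrite lt_neqAle ts0.
  split; rewrite -subr_ge0.
    apply: (ac_ge0_left acA ts0 sb) => t tt ts'.
    by rewrite subr_ge0; have [] := hs t tt ts'.
  apply: (ac_ge0_left acB ts0 sb) => t tt ts'.
  by rewrite subr_ge0; have [] := hs t tt ts'.
have [r r0 hr] := ac_gt0_right acphi ts sb (lt_le_trans (pos0 _ _ _ hc1) sA).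
have [r' r'0 hr'] := ac_gt0_right acpsi ts sb (lt_le_trans (pos0 _ _ _ hc2) sB).
exists (Num.min r r') => [|t st]; first by rewrite lt_min r0.
rewrite -ltrBlDl lt_min !ltrBlDl => /andP[tr tr'] tb.
apply: (lower_bounds (le_trans ts st) (ac_sub acphi (lexx _) tb) (ac_sub acpsi (lexx _) tb)) => //.
  by apply: ae_imp sys => u sysu tu ut; apply: sysu => //; exact: lt_le_trans tb.
move=> u tu ut; have [us|su] := ltP u s.
  by have [uA uB] := hs u tu us; split;
    [exact: lt_le_trans (pos0 _ _ _ hc1) uA|exact: lt_le_trans (pos0 _ _ _ hc2) uB].
have ub := le_trans ut tb.
by split; [apply: hr => //; exact: le_lt_trans tr|apply: hr' => //;
  exact: le_lt_trans tr'].
Qed.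

End a_priori_bounds.

(** * Caratheodory existence *)

(** Replace [u] and [v] by their values at the nearest grid point to the left. The
    resulting functions are measurable on each cell and converge pointwise. *)
Lemma caratheodory_measurable (a : R) (F : R -> R -> R -> R) (u v : R -> R) :
  (forall p q, measurable_fun (`[a, +oo[%classic : set cara) (fun t => F t p q)) ->
  (forall t, a <= t -> continuous (fun w : R * R => F t w.1 w.2)) ->
  (forall b, {within `[a, b], continuous u}) ->
  (forall b, {within `[a, b], continuous v}) ->
  measurable_fun (`[a, +oo[%classic : set cara) (fun t => F t (u t) (v t)).
Proof.
move=> mF cF cu cv.
pose tau n t : R := a + (Num.truncn ((t - a) * n.+1%:R))%:R / n.+1%:R.
have n0 n : 0 < n.+1%:R :> R by rewrite ltr0n.
have tau_le n t : a <= t -> a <= tau n t /\ tau n t <= t.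
  move=> at_; split; first by rewrite lerDl divr_ge0.
  by rewrite /tau -lerBrDl ler_pdivrMr// truncn_le mulr_ge0// subr_ge0.
have tau_gt n t : a <= t -> t - tau n t < n.+1%:R^-1.
  move=> at_; rewrite /tau opprD addrA -(ltr_pM2r (n0 n)) mulrBl divfK ?gt_eqF//.
  by rewrite mulVf ?gt_eqF// ltrBlDl natr1 truncnS_gt.
have tau_cvg (w : R -> R) t : (forall b, {within `[a, b], continuous w}) -> a <= t ->
    w (tau n t) @[n --> \oo] --> w t.
  move=> cw at_; have /subspace_continuousP cwt := cw t.
  have /cwt/cvgrPdist_lt H : `[a, t]%classic t by rewrite /= in_itv/= at_ lexx.
  apply/cvgrPdist_lt => e e0; have /H := e0.
  rewrite near_withinE => /nbhs_ballP[d /= d0 hd].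
  have := @near_infty_natSinv_lt R (PosNum d0).
  apply: filterS => n /= nd; have [ta tt] := tau_le n t at_.
  apply: hd; last by rewrite /= in_itv/= ta tt.
  by rewrite /ball/= ger0_norm ?subr_ge0//; apply: lt_trans nd; exact: tau_gt.
pose h n : cara -> R := fun t => F t (u (tau n t)) (v (tau n t)).
apply: (measurable_fun_cvg (h := h)).
  move=> n.
  pose D j : set R := `[a + j%:R / n.+1%:R, a + j.+1%:R / n.+1%:R[%classic.
  have -> : `[a, +oo[%classic = \bigcup_j D j.
    apply/seteqP; split=> t /=; rewrite ?in_itv/= ?andbT.
      move=> at_; have [_ tt] := tau_le n t at_.
      exists (Num.truncn ((t - a) * n.+1%:R)) => //; rewrite /D/= in_itv/= tt/=.
      have := tau_gt n t at_; rewrite /tau ltrBlDl -addrA; set k := Num.truncn _.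
      by rewrite -[k.+1%:R]natr1 mulrDl mul1r.
    case=> j _; rewrite /D/= in_itv/= => /andP[+ _].
    by apply: le_trans; rewrite lerDl divr_ge0.
  apply/measurable_fun_bigcup => j; first exact: measurable_leb_itv.
  have Da : D j `<=` `[a, +oo[%classic.
    move=> t; rewrite /D/= !in_itv/= andbT => /andP[+ _].
    by apply: le_trans; rewrite lerDl divr_ge0.
  have mFj := mF (u (a + j%:R / n.+1%:R)) (v (a + j%:R / n.+1%:R)).
  apply: (@eq_measurable_fun _ _ _ _ (D j : set cara)
    (fun t : cara => F t (u (a + j%:R / n.+1%:R)) (v (a + j%:R / n.+1%:R))) (h n)).
    move=> t; rewrite inE/= /D/= in_itv/= => /andP[jt tj].
    suff tj' : tau n t = a + j%:R / n.+1%:R by rewrite /h tj'.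
    rewrite /tau; congr (_ + _%:R / _); apply: truncn_def.
    rewrite -ler_pdivrMr// -ltr_pdivlMr//.
    by rewrite lerBrDl jt ltrBlDl tj.
  by apply: measurable_funS mFj => //; exact: measurable_leb_itv.
move=> t /=; rewrite in_itv/= andbT => at_.
apply: (cvg_comp (fun n => (u (tau n t), v (tau n t))) (fun w =>
  F t w.1 w.2) _ (cF t at_ (u t, v t))).
exact: (cvg_pair (tau_cvg u t cu at_) (tau_cvg v t cv at_)).
Qed.

Section equicontinuous_subsequence.
Context (I : finType).

(** Tychonoff's theorem, with basic neighbourhoods spelled out as finite sets of
    evaluation points. *)
Lemma pointwise_adherent (f : nat -> I * R -> R) (M : R) :
  (forall n p, `|f n p| <= M) ->
  exists y : I * R -> R, forall (k : nat) (s : seq (I * R)) (e : R), 0 < e ->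
    exists2 n, (k <= n)%N & forall p, p \in s -> `|f n p - y p| < e.
Proof.
move=> fM.
have cA := @tychonoff _ (fun=> R) (fun _ : I * R => `[- M, M]%classic) (fun=>
  @segment_compact R (- M) M).
have [|y [_ yc]] := cA (f @ \oo).
  by exists 0%N => // n _ p /=; rewrite in_itv/= -ler_norml.
exists y => k s e e0.
pose Y : prod_topology (fun _ : I * R => R) := y.
have nF : Filter (nbhs Y) by exact: nbhs_filter.
have ny : nbhs Y [set g | forall p, p \in s -> `|g p - y p| < e].
  elim: s => [|p s ih].
    by apply: (@filterS _ _ nF setT); [move=> g _ p; rewrite in_nil|exact: filterT].
  have := @proj_continuous _ (fun _ : I * R => R) p Y _ (nbhsx_ballx (y p) e e0).
  rewrite nbhs_simpl/= => np.
  apply: (filterS2 nF _ ih np) => g gs gp q; rewrite inE => /orP[/eqP ->|];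
    last exact: gs.
  by rewrite distrC; exact: gp.
have fk : (f @ \oo) [set f n | n in [set n | (k <= n)%N]].
  by exists k => // n kn; exists n.
have [_ [[n kn <-] fn]] := yc _ _ fk ny.
by exists n.
Qed.

(** Follow a pointwise adherent function [y] on finer and finer grids. As [y]
    inherits the modulus of continuity of the sequence, closeness on the grid
    gives convergence everywhere. *)
Lemma equicontinuous_subsequence (z : nat -> I -> R -> R) (a b M : R) : a <= b ->
  (forall n i t, a <= t -> t <= b -> `|z n i t| <= M) ->
  (forall e, 0 < e -> exists2 d, 0 < d & forall n i x y,
     a <= x -> x <= b -> a <= y -> y <= b -> `|y - x| < d ->
     `|z n i y - z n i x| <= e) ->
  exists (sigma : nat -> nat) (y : I -> R -> R), (forall k, (k <= sigma k)%N) /\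
    forall i t, a <= t -> t <= b -> z (sigma k) i t @[k --> \oo] --> y i t.
Proof.
move=> ab zM zeq.
pose clamp t : R := Num.min b (Num.max a t).
have clampE t : a <= t -> t <= b -> clamp t = t.
  by move=> at_ tb; rewrite /clamp (max_idPr at_) (min_idPr tb).
have clamp_itv t : a <= clamp t /\ clamp t <= b.
  by rewrite /clamp le_min ge_min le_max !lexx ab.
pose f n (p : I * R) := z n p.1 (clamp p.2).
have [n p|y0 hy] := @pointwise_adherent f M.
  by have [? ?] := clamp_itv p.2; exact: zM.
pose y i t := y0 (i, t).
have {}hy (k : nat) (s : seq (I * R)) (e : R) : 0 < e -> (forall p, p \in s ->
  a <= p.2 /\ p.2 <= b) ->
    exists2 n, (k <= n)%N & forall p, p \in s -> `|z n p.1 p.2 - y p.1 p.2| < e.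
  move=> e0 sab; have [n kn hn] := hy k s e e0; exists n => // -[i t] ps.
  have [at_ tb] := sab _ ps; have := hn _ ps.
  by rewrite /f/= clampE.
(* [+ 1] keeps the mesh positive when [a = b] *)
pose c := b - a + 1.
have c0 : 0 < c by rewrite ltr_wpDl// subr_ge0.
pose grid k (j : nat) : R := a + c * j%:R / k.+1%:R.
pose L k := [seq p <- [seq (i, grid k j) | i <- enum I, j <- iota 0 k.+1] | p.2 <= b].
have k0 k : 0 < k.+1%:R :> R by rewrite ltr0n.
have grid_ge k j : a <= grid k j by rewrite lerDl divr_ge0// mulr_ge0// ltW.
have /choice[sigma hs] : forall k, exists n, (k <= n)%N /\
    forall p, p \in L k -> `|z n p.1 p.2 - y p.1 p.2| < k.+1%:R^-1.
  move=> k; have [||n kn hn] := hy k (L k) (k.+1%:R^-1); last by exists n.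
    by rewrite invr_gt0.
  move=> p; rewrite mem_filter => /andP[pb /allpairsP[[i j] [_ _ pE]]]; split => //.
  by rewrite pE; exact: grid_ge.
exists sigma, y; split=> [k|i t at_ tb]; first by have [] := hs k.
apply/cvgrPdist_lt => e e0.
have e40 : 0 < e / 4 by rewrite divr_gt0.
have [d d0 hd] := zeq _ e40.
have yd x x' : a <= x -> x <= b -> a <= x' -> x' <= b -> `|x' - x| < d ->
    `|y i x' - y i x| <= e / 4.
  move=> ax xb ax' xb' xx'; apply/ler_addgt0Pr => r r0.
  have r20 : 0 < r / 2 by rewrite divr_gt0.
  have [|n _ hn] := hy 0%N [:: (i, x); (i, x')] _ r20.
    by move=> p; rewrite !inE => /orP[] /eqP ->.
  have := hn (i, x); rewrite !inE eqxx => /(_ isT)/= h1.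
  have := hn (i, x'); rewrite !inE eqxx orbT => /(_ isT)/= h2.
  have h3 := hd n i x x' ax xb ax' xb' xx'.
  rewrite (_ : y i x' - y i x = (y i x' - z n i x') + (z n i x' - z n i x) +
    (z n i x - y i x)); last by ring.
  rewrite distrC in h2.
  have := ler_normD (y i x' - z n i x' + (z n i x' - z n i x)) (z n i x - y i x).
  have := ler_normD (y i x' - z n i x') (z n i x' - z n i x).
  lra.
have m0 : 0 < Num.min (e / 4) (d / c) by rewrite lt_min e40 divr_gt0.
have := @near_infty_natSinv_lt R (PosNum m0); apply: filterS => k /=.
rewrite lt_min => /andP[ke kd].
pose q := (t - a) / c * k.+1%:R; pose j := Num.truncn q.
have q0 : 0 <= q by rewrite !mulr_ge0 ?subr_ge0// invr_ge0 ltW.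
have /andP[jq qj] := truncn_itv q0; rewrite -/j -natr1 in jq qj.
have tgE : t - grid k j = c / k.+1%:R * (q - j%:R).
  by rewrite /grid /q; field; rewrite !gt_eqF.
have gt_ : grid k j <= t.
  by rewrite -subr_ge0 tgE mulr_ge0 ?subr_ge0// divr_ge0// ltW.
have tg : t - grid k j < d.
  apply: (@lt_trans _ _ (c / k.+1%:R)); last by rewrite -ltr_pdivlMl// mulrC.
  by rewrite tgE gtr_pMr ?divr_gt0// ltrBlDl.
have jk : (j < k.+1)%N.
  rewrite -(ltr_nat R); apply: le_lt_trans jq _.
  rewrite gtr_pMl// ltr_pdivrMr// mul1r /c; lra.
have gb := le_trans gt_ tb.
have gL : (i, grid k j) \in L k.
  rewrite mem_filter; apply/andP; split => //; apply/allpairsP.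
  by exists (i, j); rewrite mem_enum mem_iota.
have [_ /(_ _ gL)/= h1] := hs k.
have tgd : `|t - grid k j| < d by rewrite ger0_norm ?subr_ge0.
have h2 := yd _ _ (grid_ge k j) gb at_ tb tgd.
have h3 := hd (sigma k) i _ _ (grid_ge k j) gb at_ tb tgd.
rewrite (_ : y i t - z (sigma k) i t = (y i t - y i (grid k j)) +
  (y i (grid k j) - z (sigma k) i (grid k j)) +
    (z (sigma k) i (grid k j) - z (sigma k) i t)); last by ring.
have {}h1 := lt_trans h1 ke; rewrite distrC in h1; rewrite distrC in h3.
have := ler_normD (y i t - y i (grid k j) +
  (y i (grid k j) - z (sigma k) i (grid k j))) (z (sigma k) i (grid k j) - z (sigma k) i t).
have := ler_normD (y i t - y i (grid k j)) (y i (grid k j) - z (sigma k) i (grid k j)).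
lra.
Qed.

End equicontinuous_subsequence.

Section caratheodory_existence.

(** [prim] vanishes to the left of [a], which makes estimates valid without
    comparing the arguments with [a]. *)
Lemma prim_max (a : R) f t : loc_integrable a f -> prim a f t = prim a f (Num.max a t).
Proof.
move=> lf; have [at_|ta] := leP a t; first by [].
by rewrite prim_xx// prim_lt.
Qed.

Lemma prim_dominated (a t t' : R) f m : loc_integrable a f -> loc_integrable a m ->
  (forall s, a <= s -> `|f s| <= m s) -> t <= t' ->
  `|prim a f t' - prim a f t| <= prim a m t' - prim a m t.
Proof.
move=> lf lm fm tt';
  rewrite (prim_max t' lf) (prim_max t lf) (prim_max t' lm) (prim_max t lm).
have ax : a <= Num.max a t by rewrite le_max lexx.
have xy : Num.max a t <= Num.max a t' by rewrite ge_max !le_max lexx tt' orbT.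
move: ax xy; set x := Num.max a t; set y := Num.max a t' => ax xy.
rewrite -!prim_sub// /prim.
have mD : measurable (`[x, y]%classic : set cara) by exact: measurable_leb_itv.
have lfx := loc_integrable_ge lf ax; have lmx := loc_integrable_ge lm ax.
apply: (le_trans (le_normr_Rintegral mD (lfx y))).
apply: le_Rintegral => //; first exact: loc_integrable_norm.
by move=> s; rewrite /= in_itv/= => /andP[xs _]; apply: fm; exact: le_trans xs.
Qed.

Lemma prim_dominated_norm (a t t' : R) f m : loc_integrable a f -> loc_integrable a m ->
  (forall s, a <= s -> `|f s| <= m s) ->
  `|prim a f t' - prim a f t| <= `|prim a m t' - prim a m t|.
Proof.
move=> lf lm fm; have [tt'|/ltW t't] := leP t t'.
  exact: le_trans (prim_dominated lf lm fm tt') (ler_norm _).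
rewrite distrC [leRHS]distrC.
exact: le_trans (prim_dominated lf lm fm t't) (ler_norm _).
Qed.

Lemma prim_unif_continuous (a : R) m : loc_integrable a m ->
  forall (b e : R), a <= b -> 0 < e -> exists2 d, 0 < d & forall x y, x <= b ->
    y <= b ->
    `|y - x| < d -> `|prim a m y - prim a m x| < e.
Proof.
move=> lm b e ab e0; have [d d0 hd] := ac_unif_continuous (prim_ac b lm) e0.
exists d => // x y xb yb xy.
rewrite (prim_max y lm) (prim_max x lm).
apply: hd; rewrite ?le_max ?ge_max ?lexx ?ab//.
apply: le_lt_trans xy; have [ax|xa] := leP a x; have [ay|ya] := leP a y => //.
- by rewrite !ler0_norm ?subr_le0 ?(ltW ya)//; lra.
- by rewrite !ger0_norm ?subr_ge0; lra.
- by rewrite subrr normr0.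
Qed.

Context (a : R) (F : bool -> R -> R -> R -> R) (m : R -> R)
  (mF : forall i p q, measurable_fun (`[a, +oo[%classic : set cara) (fun t =>
    F i t p q))
  (cF : forall i t, a <= t -> continuous (fun w : R * R => F i t w.1 w.2))
  (lm : loc_integrable a m)
  (Fm : forall i t p q, a <= t -> `|F i t p q| <= m t).

Let G (y : bool -> R -> R) i s := F i s (y true s) (y false s).
Let regular (y : bool -> R -> R) := forall i b, {within `[a, b], continuous (y i)}.

Let G_measurable y i : regular y ->
  measurable_fun (`[a, +oo[%classic : set cara) (G y i).
Proof.
by move=> ry; apply: caratheodory_measurable => //; exact: cF.
Qed.

Let G_loc_integrable y i : regular y -> loc_integrable a (G y i).
Proof.
move=> ry b; apply: le_integrable (lm b).
- exact: measurable_leb_itv.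
- apply/measurable_EFinP; apply: measurable_funS (G_measurable i ry).
    exact: measurable_leb_itv.
  by move=> s /=; rewrite !in_itv/= => /andP[->].
- move=> s; rewrite /= in_itv/= => /andP[as_ _]; rewrite lee_fin.
  by apply: le_trans (ler_norm _); exact: Fm.
Qed.

Context (y0 : bool -> R).
(** Tonelli's scheme: the state enters the integral with a delay [h], so that the
    equation [y = delayed h y] is solved by finitely many iterations. *)
Let delayed h (y : bool -> R -> R) i t := y0 i + prim a (G y i) (t - h).

Let delayed_regular h y : 0 <= h -> regular y -> regular (delayed h y).
Proof.
move=> h0 ry i b; have [ab|ba] := leP a b; last first.
  by rewrite set_itv_ge ?bnd_simp -?ltNge//; exact: continuous_subspace0.
apply: unif_continuous_within => e e0.
have [d d0 hd] := prim_unif_continuous (G_loc_integrable i ry) ab e0.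
exists d => // x y' _ xb _ yb xy; rewrite /delayed opprD addrACA subrr add0r.
by apply: hd; rewrite ?lerBlDr;
  [exact: ler_wpDr|exact: ler_wpDr|rewrite opprB addrA subrK].
Qed.

Let approx h n := iter n (delayed h) (fun i _ => y0 i).

Let approx_regular h n : 0 <= h -> regular (approx h n).
Proof.
move=> h0; elim: n => [|n ih] /=; last exact: delayed_regular.
by move=> i b; apply: continuous_subspaceT => t; exact: cvg_cst.
Qed.

(** Each iteration settles the values on a further interval of length [h]. *)
Let approx_stationary h n i t : 0 < h -> t <= a + n%:R * h ->
  approx h n.+1 i t = approx h n i t.
Proof.
move=> h0; elim: n i t => [|n ih] i t.
  rewrite mul0r addr0 => ta; rewrite /= /delayed prim_lt ?addr0//.
  by rewrite ltrBlDr; apply: le_lt_trans ta _; rewrite ltrDl.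
rewrite -natr1 mulrDl mul1r addrA -lerBlDr => tn.
change (delayed h (approx h n.+1) i t = delayed h (approx h n) i t).
rewrite /delayed; apply/(congr1 (+%R (y0 i)))/eq_prim => s as_ st.
have st' := le_trans st tn.
by rewrite /G (ih true s st') (ih false s st').
Qed.

(** The solutions [z n] of the delayed equations are equicontinuous, since their
    increments are dominated by those of [prim m]. Along a pointwise convergent
    subsequence, dominated convergence turns the delayed equation into the
    original one. The derivative [g] is produced rather than the solution, which
    is [y0 + prim g]. *)
Lemma caratheodory_existence b : a <= b ->
  exists g : bool -> R -> R, [/\ forall i, loc_integrable a (g i),
    forall i t, a <= t -> `|g i t| <= m t &
    forall i t, a <= t -> t <= b ->
      g i t = F i t (y0 true + prim a (g true) t) (y0 false + prim a (g false) t)].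
Proof.
move=> ab.
pose h n : R := (b - a + 1) / n.+1%:R.
have h0 n : 0 < h n by rewrite divr_gt0// ltr_wpDl// subr_ge0.
pose z n := approx (h n) n.+1.
have rz n : regular (z n) by apply: approx_regular; exact: ltW.
have lz n i : loc_integrable a (G (z n) i) by exact: G_loc_integrable.
have zE n i t : t <= b -> z n i t = y0 i + prim a (G (z n) i) (t - h n).
  move=> tb; rewrite /z -approx_stationary//= /h mulrCA divff// mulr1; lra.
have Gm y i s : a <= s -> `|G y i s| <= m s by move=> as_; exact: Fm.
have [||sigma [y [sk hy]]] := @equicontinuous_subsequence bool z a b
   (`|y0 true| + `|y0 false| + prim a m b) ab.
- move=> n i t at_ tb; rewrite zE//.
  have thb : t - h n <= b by rewrite (le_trans _ tb)// gerBl ltW.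
  have h1 : `|prim a (G (z n) i) (t - h n)| <= prim a m b.
    rewrite (prim_max _ (lz n i)); set s := Num.max _ _.
    have as_ : a <= s by rewrite le_max lexx.
    have sb : s <= b by rewrite ge_max ab.
    have := prim_dominated (lz n i) lm (Gm _ i) as_.
    rewrite !prim_xx// !subr0 => /le_trans; apply; rewrite -subr_ge0.
    exact: le_trans (normr_ge0 _) (prim_dominated (lz n i) lm (Gm _ i) sb).
  apply: (le_trans (ler_normD _ _)); apply: lerD => //.
  by case: i {h1}; rewrite ?lerDl ?lerDr.
- move=> e e0; have [d d0 hd] := prim_unif_continuous lm ab e0.
  exists d => // n i x x' _ xb _ xb' xx'; rewrite !zE// opprD addrACA subrr add0r.
  apply: (le_trans (prim_dominated_norm _ _ (lz n i) lm (Gm _ i))).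
  have hb v : v <= b -> v - h n <= b by move=> vb; rewrite (le_trans _ vb)// gerBl ltW.
  apply/ltW/hd; [exact: hb|exact: hb|].
  by rewrite opprB addrA subrK.
have cvGz i s : a <= s -> s <= b -> G (z (sigma k)) i s @[k --> \oo] --> G y i s.
  move=> as_ sb; rewrite /G.
  apply: (cvg_comp (fun k => (z (sigma k) true s, z (sigma k) false s))
    (fun w => F i s w.1 w.2) _ (@cF i s as_ (y true s, y false s))).
  exact: (cvg_pair (hy true s as_ sb) (hy false s as_ sb)).
have mGz n i t : measurable_fun (`[a, t]%classic : set cara) (G (z n) i).
  apply: measurable_funS (G_measurable i (rz n)); first exact: measurable_leb_itv.
  by move=> s /=; rewrite !in_itv/= => /andP[->].
have mGy i t : t <= b -> measurable_fun (`[a, t]%classic : set cara) (G y i).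
  move=> tb; pose f k : cara -> R := G (z (sigma k)) i.
  apply: (measurable_fun_cvg (h := f)); first by move=> k; exact: mGz.
  move=> s; rewrite /= in_itv/= => /andP[as_ st].
  by apply: cvGz => //; exact: le_trans tb.
have dct i t : a <= t -> t <= b -> (leb R).-integrable `[a, t] (EFin \o G y i) /\
   prim a (G (z (sigma k)) i) t @[k --> \oo] --> prim a (G y i) t.
  move=> at_ tb.
  have mD : measurable (`[a, t]%classic : set cara) by exact: measurable_leb_itv.
  pose f k : cara -> \bar R := EFin \o G (z (sigma k)) i.
  have [|||||iG _ cG] :=
    @dominated_convergence _ _ _ (leb R) _ mD f (EFin \o G y i) (EFin \o m).
  - by move=> k; apply/measurable_EFinP; exact: mGz.
  - by apply/measurable_EFinP; exact: mGy.
  - apply/aeW => s; rewrite /= in_itv/= => /andP[as_ st].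
    apply/cvg_EFin; first by apply: nearW.
    by apply: cvGz => //; exact: le_trans tb.
  - exact: lm.
  - apply/aeW => s k; rewrite /= in_itv/= => /andP[as_ st].
    by rewrite lee_fin; exact: Gm.
  split=> //; apply: fine_cvg; rewrite fineK//.
  exact: integrable_fin_num.
have yE i t : a <= t -> t <= b -> y i t = y0 i + prim a (G y i) t.
  move=> at_ tb; apply: (cvg_unique _ (hy i t at_ tb)) => //.
  have [_ cG] := dct i t at_ tb.
  apply/cvgrPdist_lt => e e0; have e20 : 0 < e / 2 by rewrite divr_gt0.
  have [d d0 hd] := prim_unif_continuous lm ab e20.
  have c0 : 0 < b - a + 1 by rewrite ltr_wpDl// subr_ge0.
  have m0 : 0 < d / (b - a + 1) by rewrite divr_gt0.
  move/cvgrPdist_lt/(_ _ e20): cG.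
  have := @near_infty_natSinv_lt R (PosNum m0); apply: filterS2 => k /= kd.
  set A := prim a (G y i) t; set B := prim a _ t => AB.
  rewrite zE//; set C := prim a _ (t - _).
  have : `|B - C| < e / 2.
    apply: (le_lt_trans (prim_dominated_norm _ _ (lz _ i) lm (Gm _ i))).
    apply: hd => //; first by rewrite (le_trans _ tb)// gerBl ltW.
    rewrite opprB addrC subrK gtr0_norm// /h.
    apply: (@le_lt_trans _ _ ((b - a + 1) / k.+1%:R)).
      by rewrite ler_pM2l// lef_pV2 ?posrE// ler_nat ltnS.
    by rewrite -ltr_pdivlMl// mulrC.
  have -> : y0 i + A - (y0 i + C) = (A - B) + (B - C) by ring.
  have := ler_normD (A - B) (B - C); lra.
have gE i : {in `[a, b], (G y i \_ `[a, b]) =1 G y i}.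
  by move=> t tab; rewrite patchE mem_set.
have lg i : loc_integrable a (G y i \_ `[a, b]).
  have [iG _] := dct i b ab (lexx b); move: iG.
  rewrite integrable_mkcond; last exact: measurable_leb_itv.
  rewrite restrict_EFin => iG c.
  by apply: integrableS iG => //; exact: measurable_leb_itv.
exists (fun i => G y i \_ `[a, b]); split => //.
- move=> i t at_; rewrite patchE; case: ifPn => _; first exact: Gm.
  by rewrite normr0 (le_trans (normr_ge0 _) (Gm y i t at_)).
- move=> i t at_ tb; rewrite gE ?in_itv/= ?at_//.
  have yg j : y j t = y0 j + prim a (G y j \_ `[a, b]) t.
    rewrite yE//; congr (_ + _); apply: eq_prim => s as_ st.
    by rewrite gE// in_itv/= as_ (le_trans st).
  by rewrite /G (yg true) (yg false).
Qed.

End caratheodory_existence.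

(** * Continuation past a finite end point *)

(** [phi + mh] is nondecreasing and bounded, hence converges to its supremum. *)
Lemma dominated_left_limit (a b : R) (phi mh : R -> R) : a < b ->
  (forall x y, a <= x -> x <= y -> y < b -> `|phi y - phi x| <= mh y - mh x) ->
  (forall x, a <= x -> x < b -> mh x <= mh b) ->
  exists l, forall x, a <= x -> x < b -> `|l - phi x| <= mh b - mh x.
Proof.
move=> ab dom mono.
pose E := [set phi x + mh x | x in [set x | a <= x /\ x < b]].
have E0 : E (phi a + mh a) by exists a.
have ubE x : a <= x -> x < b -> ubound E (phi x + (mh b - mh x) + mh b).
  move=> ax xb _ [t [at_ tb] <-].
  have mt := mono t at_ tb; have mx := mono x ax xb.
  have [xt|/ltW tx] := leP x t.
    by have := dom x t ax xt tb; rewrite ler_norml => /andP[_ ?]; lra.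
  by have := dom t x at_ tx xb; rewrite ler_norml => /andP[? _]; lra.
have hsE : has_sup E by split; [exists (phi a + mh a)|exists (phi a +
  (mh b - mh a) + mh b); exact: ubE].
exists (sup E - mh b) => x ax xb; rewrite ler_norml; apply/andP; split.
  have : phi x + mh x <= sup E by apply: sup_upper_bound => //; exists x.
  lra.
have : sup E <= phi x + (mh b - mh x) + mh b by apply: ge_sup (ubE x ax xb);
  exists (phi a + mh a).
lra.
Qed.

(** A right-hand side given on [a, b] only is extended by zero. *)
Lemma caratheodory_existence_on (a b : R) (F : bool -> R -> R -> R -> R) (m : R -> R)
    (y0 : bool -> R) : a <= b ->
  (forall i p q, measurable_fun (`[a, b]%classic : set cara) (fun t => F i t p q)) ->
  (forall i t, a <= t -> t <= b -> continuous (fun w : R * R => F i t w.1 w.2)) ->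
  loc_integrable a m -> (forall t, a <= t -> 0 <= m t) ->
  (forall i t p q, a <= t -> t <= b -> `|F i t p q| <= m t) ->
  exists g : bool -> R -> R, [/\ forall i, loc_integrable a (g i),
    forall i t, a <= t -> `|g i t| <= m t &
    forall i t, a <= t -> t <= b ->
      g i t = F i t (y0 true + prim a (g true) t) (y0 false + prim a (g false) t)].
Proof.
move=> ab mF cF lm m0 Fm.
pose F' i t p q : R := if t <= b then F i t p q else 0.
have [|||g [lg gm gE]] := @caratheodory_existence a F' m _ _ lm _ y0 b ab.
- move=> i p q.
  have : measurable_fun (`[a, +oo[%classic : set cara) ((fun t : cara =>
    F i t p q) \_ `[a, b]%classic).
    apply/measurable_restrict; [exact: measurable_leb_itv|exact: measurable_leb_itv|].
    apply: measurable_funS (mF i p q); first exact: measurable_leb_itv.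
    exact: subIsetr.
  apply: eq_measurable_fun => t; rewrite inE/= in_itv/= andbT => at_.
  have tabE : (t \in `[a, b]%classic) = (t <= b).
    by apply/idP/idP; rewrite inE/= in_itv/= at_.
  by rewrite /F' patchE tabE.
- move=> i t at_; rewrite /F'; case: (leP t b) => tb; first exact: cF.
  by move=> w; exact: cvg_cst.
- move=> i t p q at_; rewrite /F'; case: ifPn => tb; first exact: Fm.
  by rewrite normr0; exact: m0.
exists g; split=> // i t at_ tb.
by rewrite gE// /F' tb.
Qed.

Lemma norm_le_between (x lo hi : R) : lo <= x <= hi -> `|x| <= `|lo| + `|hi|.
Proof.
move=> /andP[lx xh]; rewrite ler_norml; apply/andP; split.
  by have := ler_norm (- lo); rewrite normrN; have := normr_ge0 hi; lra.
by have := ler_norm hi; have := normr_ge0 lo; lra.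
Qed.

Lemma ler_norm_combination (x y u v X Y M : R) : `|x| <= X -> `|y| <= Y ->
  0 <= u -> u <= M -> 0 <= v -> v <= M -> `|x * u + y * v| <= M * (X + Y).
Proof.
move=> xX yY u0 uM v0 vM; apply: (le_trans (ler_normD _ _)).
rewrite !normrM (ger0_norm u0) (ger0_norm v0) mulrDr lerD// mulrC.
  exact: ler_pM.
exact: ler_pM.
Qed.

Definition clamp (lo hi x : R) : R := Num.max lo (Num.min hi x).

Lemma clamp_itv lo hi x : lo <= hi -> lo <= clamp lo hi x /\ clamp lo hi x <= hi.
Proof. by move=> lh; rewrite /clamp le_max lexx ge_max lh ge_min lexx. Qed.

Lemma clamp_id lo hi x : lo <= x -> x <= hi -> clamp lo hi x = x.
Proof. by move=> lx xh; rewrite /clamp (min_idPr xh) (max_idPr lx). Qed.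

Lemma clamp_continuous lo hi : continuous (clamp lo hi).
Proof.
move=> x; apply: continuous_max; first exact: cst_continuous.
by apply: continuous_min; [exact: cst_continuous|exact: id].
Qed.

Lemma ae_neq (c : R) : {ae lam, forall t, t != c}.
Proof.
exists [set c]; split; [exact: measurable_set1|exact: lebesgue_measure_set1|].
by move=> t /= /negP; rewrite negbK => /eqP.
Qed.

Definition glue (c : R) (f g : R -> R) t := if t < c then f t else g t.

Lemma glue_derive_left (c t l : R) (f g : R -> R) : t < c -> is_derive t 1 f l ->
  is_derive t 1 (glue c f g) l.
Proof.
move=> tc; apply: near_eq_is_derive.
by near=> s; rewrite /glue ifT//; near: s; exact: lt_nbhsl.
Unshelve. all: by end_near. Qed.

Lemma glue_derive_right (c t l : R) (f g : R -> R) : c < t ->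
  is_derive t 1 g l -> is_derive t 1 (glue c f g) l.
Proof.
move=> ct; apply: near_eq_is_derive.
near=> s; rewrite /glue ifF//; apply/negbTE; rewrite -leNgt ltW//.
by near: s; exact: lt_nbhsr.
Unshelve. all: by end_near. Qed.

(** An estimate of the increments by those of one primitive survives gluing, and
    it implies absolute continuity. *)
Lemma glue_dominated (a c : R) (m phi gm : R -> R) (l : R) : a < c ->
  loc_integrable a m -> loc_integrable c gm -> 
  (forall t, c <= t -> `|gm t| <= m t) ->
  (forall x y, a <= x -> x <= y -> y < c ->
    `|phi y - phi x| <= prim a m y - prim a m x) ->
  (forall x, a <= x -> x < c -> `|l - phi x| <= prim a m c - prim a m x) ->
  forall b, abs_continuous a b (glue c phi (fun t => l + prim c gm t)).
Proof.
move=> ac lm lg gmm dphi dl b.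
apply: (ac_lipschitz (C := 1) (prim_ac b lm)) => x y ax xy yb.
rewrite mul1r; apply: le_trans (ler_norm _).
have lmc := loc_integrable_ge lm (ltW ac).
have right z z' : c <= z -> z <= z' ->
    `|prim c gm z' - prim c gm z| <= prim a m z' - prim a m z.
  move=> cz zz'; apply: (le_trans (prim_dominated lg lmc gmm zz')).
  rewrite (prim_sub lm (ltW ac) cz) (prim_sub lm (ltW ac) (le_trans cz zz')).
  by rewrite opprB addrA subrK.
rewrite /glue; case: (ltP y c) => yc.
  by rewrite (le_lt_trans xy yc); exact: dphi.
case: (ltP x c) => xc; last by rewrite opprD addrACA subrr add0r; exact: right.
have := right c y (lexx c) yc; rewrite prim_xx// subr0 => h1.
have h2 := dl x ax xc.
rewrite addrAC; apply: (le_trans (ler_normD _ _)); lra.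
Qed.

Section continuation_theorem.

Lemma admissible_clamped_measurable (t0 a b d k l p q : R) (F : R -> R -> R -> R) :
  admissible t0 F -> t0 <= a -> 0 < d -> d <= k -> d <= l ->
  measurable_fun (`[a, b]%classic : set cara)
    (fun t => F t (clamp d k p) (clamp d l q)).
Proof.
move=> [mF _] t0a d0 dk dl.
have [dp _] := clamp_itv p dk; have [dq _] := clamp_itv q dl.
have /loc_integrable_measurable : loc_integrable t0 (fun t =>
  F t (clamp d k p) (clamp d l q)).
  by apply: mF; rewrite gt_eqF// (lt_le_trans d0).
apply: measurable_funS; first exact: measurable_leb_itv.
by move=> s /=; rewrite !in_itv/= andbT => /andP[/(le_trans t0a)].
Qed.

(** Clamping maps the plane into the domain of the coefficients, away from the
    axes. *)
Lemma admissible_clamped_continuous (t0 t d k l : R) (F : R -> R -> R -> R) :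
  admissible t0 F -> t0 <= t -> 0 < d -> d <= k -> d <= l ->
  continuous (fun w : R * R => F t (clamp d k w.1) (clamp d l w.2)).
Proof.
move=> [_ cF] t0t d0 dk dl w.
have /subspace_continuousP cFt := cF t t0t.
have [dp _] := clamp_itv w.1 dk; have [dq _] := clamp_itv w.2 dl.
pose cl (w : R * R) := (clamp d k w.1, clamp d l w.2).
have in_dom w' : [set w : R * R | w.1 != 0 /\ w.2 != 0] (cl w').
  have [dp' _] := clamp_itv w'.1 dk; have [dq' _] := clamp_itv w'.2 dl.
  by rewrite /cl /=; split; rewrite gt_eqF// (lt_le_trans d0).
have c1 : clamp d k w'.1 @[w' --> w] --> clamp d k w.1.
  by apply: (cvg_comp (fun w' : R * R =>
    w'.1) (clamp d k) _ (@clamp_continuous d k w.1)); exact: cvg_fst.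
have c2 : clamp d l w'.2 @[w' --> w] --> clamp d l w.2.
  by apply: (cvg_comp (fun w' : R * R =>
    w'.2) (clamp d l) _ (@clamp_continuous d l w.2)); exact: cvg_snd.
have ccl : cl w' @[w' --> w] --> cl w by exact: (cvg_pair c1 c2).
have := cFt (cl w) (in_dom w).
apply: (cvg_comp cl (fun w : R * R => F t w.1 w.2)).
move=> A; rewrite /within/= => /ccl; rewrite !nbhs_simpl/=.
by apply: filterS => w' /(_ (in_dom w')).
Qed.

Context (t0 : R) (P Q Rf S : R -> R -> R -> R) (alpha beta : R -> R)
  (Pd Qd Rd Sd B1d B2d : R -> R -> R)
  (hP : admissible t0 P) (hQ : admissible t0 Q)
  (hR : admissible t0 Rf) (hS : admissible t0 S)
  (halpha : loc_integrable t0 alpha) (hbeta : loc_integrable t0 beta)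
  (hd : forall delta : R, 0 < delta ->
     [/\ loc_integrable t0 (Pd delta), loc_integrable t0 (Qd delta) &
         loc_integrable t0 (Rd delta)] /\
     [/\ loc_integrable t0 (Sd delta), loc_integrable t0 (B1d delta) &
         loc_integrable t0 (B2d delta)])
  (c1 c2 eps : R) (hc1 : 0 < c1) (hc2 : 0 < c2) (heps : 0 < eps).
Let K d t := Kbound t0 (Pd d) (Qd d) (Rd d) (B1d d) t c1 c2.
Let L d t := Lbound t0 (Sd d) (Rd d) (Qd d) (B2d d) t c1 c2.
Context (hbounds : forall delta t u v : R,
     0 < delta -> delta < eps -> t0 <= t ->
     delta <= u -> u <= K delta t + eps ->
     delta <= v -> v <= L delta t + eps ->
     [/\ alpha t <= P t u v <= Pd delta t,
         beta t <= S t u v <= Sd delta t,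
         0 <= Q t u v <= Qd delta t,
         0 <= Rf t u v <= Rd delta t &
         B1d delta t <= P t u v - S t u v <= B2d delta t]).

Let rhs (i : bool) t u v := if i then P t u v * u +
  Q t u v * v else Rf t u v * u + S t u v * v.
Let total d t := `|alpha t| + `|beta t| + `|Pd d t| + `|Sd d t| + `|Qd d t| + `|Rd d t|.

Let total_loc_integrable d : 0 < d -> loc_integrable t0 (total d).
Proof.
move=> /hd[[lP lQ lR] [lS lB1 lB2]].
by rewrite /total; do ![exact: loc_integrable_norm|apply: loc_integrableD].
Qed.

Let rhs_dominated d M i t u v : 0 < d -> d < eps -> t0 <= t ->
  d <= u -> u <= K d t + eps -> d <= v -> v <= L d t + eps -> u <= M -> v <= M ->
  `|rhs i t u v| <= M * total d t.
Proof.
move=> d0 de tt du uK dv vL uM vM.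
have [bP bS bQ bR _] := hbounds d0 de tt du uK dv vL.
have u0 : 0 <= u by exact: le_trans (ltW d0) du.
have v0 : 0 <= v by exact: le_trans (ltW d0) dv.
have M0 : 0 <= M by exact: le_trans uM.
have {}bP := norm_le_between bP; have {}bS := norm_le_between bS.
have {}bQ := norm_le_between bQ; have {}bR := norm_le_between bR.
rewrite normr0 add0r in bQ; rewrite normr0 add0r in bR.
have nneg (x : R) : 0 <= `|x| by exact: normr_ge0.
have := nneg (alpha t); have := nneg (beta t); have := nneg (Pd d t).
have := nneg (Sd d t); have := nneg (Qd d t); have := nneg (Rd d t).
move=> nR nQ nS nP nb na.
case: i; rewrite /rhs.
  apply: (le_trans (ler_norm_combination bP bQ u0 uM v0 vM)).
  apply: ler_wpM2l => //; rewrite /total.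
  move: nR nQ nS nP nb na; move: `|_| `|_| `|_| `|_| `|_| `|_| =>
    x1 x2 x3 x4 x5 x6; lra.
apply: (le_trans (ler_norm_combination bR bS u0 uM v0 vM)).
apply: ler_wpM2l => //; rewrite /total.
move: nR nQ nS nP nb na; move: `|_| `|_| `|_| `|_| `|_| `|_| => x1 x2 x3 x4 x5 x6; lra.
Qed.

Context (c : R) (phi psi : R -> R) (t0c : t0 < c)
  (sol : is_solution P Q Rf S t0 c%:E phi psi)
  (phi0 : phi t0 = c1) (psi0 : psi t0 = c2).

Let acphi b : b < c -> abs_continuous t0 b phi.
Proof.
move=> bc; have [_ acp _ _] := sol; have [tb|bt] := leP t0 b.
  by apply: acp => //; rewrite lte_fin.
apply: (ac_sub (a := t0) (b := t0)) => //; last exact: ltW.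
by apply: acp => //; rewrite lte_fin.
Qed.

Let acpsi b : b < c -> abs_continuous t0 b psi.
Proof.
move=> bc; have [_ _ acp _] := sol; have [tb|bt] := leP t0 b.
  by apply: acp => //; rewrite lte_fin.
apply: (ac_sub (a := t0) (b := t0)) => //; last exact: ltW.
by apply: acp => //; rewrite lte_fin.
Qed.

Let sys : {ae lam, forall t, t0 <= t -> t < c -> satisfies_system P Q Rf S phi psi t}.
Proof. by have [_ _ _ /ae_leb_lam] := sol. Qed.

Let sys_lt b : b <= c -> {ae lam, forall t, t0 < t -> t < b ->
  satisfies_system P Q Rf S phi psi t}.
Proof.
by move=> bc; apply: ae_imp sys => t h t0t tb; apply: h;
  [exact: ltW|exact: lt_le_trans bc].
Qed.

(** The floor is stated as [d + d] to keep the solution, and its limit at [c],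
    strictly above the lower side [d] of the region. *)
Let positive_floor : exists2 d, 0 < d & d < eps /\
  forall t, t0 <= t -> t < c -> d + d <= phi t /\ d + d <= psi t.
Proof.
have floor (k : R) (al : R -> R) : 0 < k -> loc_integrable t0 al ->
    exists2 e, 0 < e & forall t, t0 <= t -> t <= c -> e <= k * expR (prim t0 al t).
  move=> k0 lal; apply: ac_gt0_min; first exact: ltW.
    by apply: acM; [exact: ac_cst|exact/ac_expR/prim_ac].
  by move=> t _ _; rewrite mulr_gt0// expR_gt0.
have [e1 e10 h1] := floor _ _ hc1 halpha; have [e2 e20 h2] := floor _ _ hc2 hbeta.
pose d := Num.min (Num.min e1 e2) eps / 2.
have m0 : 0 < Num.min (Num.min e1 e2) eps by rewrite !lt_min e10 e20.
have dd : d + d = Num.min (Num.min e1 e2) eps by rewrite /d -splitr.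
exists d; first by rewrite divr_gt0.
split=> [|t tt tc].
  apply: (@lt_le_trans _ _ (d + d)); first by rewrite ltrDl divr_gt0.
  by rewrite dd ge_min lexx orbT.
have [l1 l2] := solution_lower_bounds halpha hbeta hd hc1 hc2 heps hbounds tt
  (acphi tc) (acpsi tc) phi0 psi0 (sys_lt (ltW tc)) tt (lexx t).
rewrite dd; split.
  by apply: le_trans l1; apply: le_trans (h1 t tt (ltW tc)); rewrite !ge_min lexx.
by apply: le_trans l2; apply: le_trans (h2 t tt (ltW tc)); rewrite !ge_min lexx orbT.
Qed.

Let dominated_increments (w : R -> R) (i : bool) (m : R -> R) : loc_integrable t0 m ->
  (forall b, b < c -> abs_continuous t0 b w) ->
  {ae lam, forall t, t0 < t -> t < c -> exists2 l, is_derive t 1 w l & `|l| <= m t} ->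
  forall x y, t0 <= x -> x <= y -> y < c -> `|w y - w x| <= prim t0 m y - prim t0 m x.
Proof.
move=> lm acw dw x y tx xy yc; rewrite -(prim_sub lm tx xy).
have lmx := loc_integrable_ge lm tx.
have acwx := ac_sub (acw y yc) tx (lexx y).
have dwx : {ae lam, forall t, x < t -> t < y -> exists2 l,
  is_derive t 1 w l & `|l| <= m t}.
  by apply: ae_imp dw => t dw xt ty; apply: dw;
    [exact: le_lt_trans xt|exact: lt_trans yc].
rewrite ler_norml; apply/andP; split.
  rewrite lerNl opprB -[w x]opprK -[- w y]/((fun t => - w t) y) addrC.
  apply: (ac_le_prim (w := fun t => - w t) xy (acN acwx) lmx).
  apply: ae_imp dwx => t dwx xt ty; have [l dl lmt] := dwx xt ty.
  exists (- l); first exact: is_deriveN.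
  by rewrite (le_trans (ler_norm _))// normrN.
apply: (ac_le_prim xy acwx lmx).
apply: ae_imp dwx => t dwx xt ty; have [l dl lmt] := dwx xt ty.
by exists l => //; rewrite (le_trans (ler_norm _)).
Qed.

(** Inequalities on [t0, c[ pass to the limit [l], which is the value at [c] of
    [w] glued to the constant [l]. *)
Let limit_between (w : R -> R) (l : R) :
  abs_continuous t0 c (glue c w (fun t => l + prim c (fun=> 0) t)) ->
  forall h, abs_continuous t0 c h ->
  ((forall t, t0 <= t -> t < c -> w t <= h t) -> l <= h c) /\
  ((forall t, t0 <= t -> t < c -> h t <= w t) -> h c <= l).
Proof.
move=> acg h ach.
have gc : glue c w (fun t => l + prim c (fun=> 0) t) c = l.
  by rewrite /glue ltxx prim0 addr0.
split=> wh; rewrite -subr_ge0 -gc.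
  apply: (ac_ge0_left (acD ach (acN acg)) t0c (lexx c)) => t tt tc.
  by rewrite /glue tc subr_ge0; exact: wh.
apply: (ac_ge0_left (acD acg (acN ach)) t0c (lexx c)) => t tt tc.
by rewrite /glue tc subr_ge0; exact: wh.
Qed.

(** Beyond [c] the solution is that of the system clamped to the box
    [d, k] x [d, l]. Its initial values are interior to the box, so it stays inside
    for a while and solves the original system there. *)
Lemma solution_continues : exists (T' : \bar R) (phi' psi' : R -> R),
  [/\ (c%:E < T')%E, is_solution P Q Rf S t0 T' phi' psi' &
      forall t, t0 <= t -> (t%:E < c%:E)%E -> phi' t = phi t /\ psi' t = psi t].
Proof.
have [d d0 [de floor]] := positive_floor.
have ddd : d <= d + d by rewrite lerDl ltW.
have hge t : t0 <= t -> t < c -> d <= phi t /\ d <= psi t.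
  by move=> tt tc; have [? ?] := floor t tt tc; split; exact: le_trans ddd _.
have ub t : t0 <= t -> t < c -> phi t <= K d t /\ psi t <= L d t.
  move=> tt tc.
  have hget s : t0 <= s -> s <= t -> d <= phi s /\ d <= psi s.
    by move=> ts st; apply: hge => //; exact: le_lt_trans tc.
  exact: (upper_bounds hd heps hbounds (acphi tc) (acpsi tc) phi0 psi0
    (sys_lt (ltW tc)) d0 de hget tt (lexx t)).
have acK b : abs_continuous t0 b (K d) by apply: (K_ac hd).
have acL b : abs_continuous t0 b (L d) by apply: (L_ac hd).
have [MK MK0 hMK] := ac_bounded (acK (c + 1)).
have [ML ML0 hML] := ac_bounded (acL (c + 1)).
pose M := MK + ML + eps.
pose m t := M * total d t.
have lm : loc_integrable t0 m by apply/loc_integrableZ/total_loc_integrable.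
have M0 : 0 <= M by rewrite !addr_ge0// ltW.
have m0 t : 0 <= m t by rewrite mulr_ge0// !addr_ge0.
have up x : x <= x + eps by rewrite lerDl ltW.
have leM t : t0 <= t -> t <= c + 1 -> K d t + eps <= M /\ L d t + eps <= M.
  move=> tt tc; have := le_trans (ler_norm _) (hMK t tt tc).
  have := le_trans (ler_norm _) (hML t tt tc).
  move: (K d t) (L d t) => k l kM lM; rewrite /M; split; lra.
have rhs_phi i t : t0 <= t -> t < c -> `|rhs i t (phi t) (psi t)| <= m t.
  move=> tt tc; have [g1 g2] := hge t tt tc; have [u1 u2] := ub t tt tc.
  have [|M1 M2] := leM t tt; first by rewrite (le_trans (ltW tc))// lerDl.
  apply: rhs_dominated => //; [exact: le_trans u1 (up _)|exact: le_trans u2 (up _)|..].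
    exact: le_trans (le_trans u1 (up _)) M1.
  exact: le_trans (le_trans u2 (up _)) M2.
have domphi : forall x y, t0 <= x -> x <= y -> y < c ->
  `|phi y - phi x| <= prim t0 m y - prim t0 m x.
  apply: (dominated_increments true lm acphi); apply: ae_imp sys => t syst tt tc.
  have [_ _ dphi _] := syst (ltW tt) tc.
  by eexists; [exact: dphi|exact: (rhs_phi true t (ltW tt) tc)].
have dompsi : forall x y, t0 <= x -> x <= y -> y < c ->
  `|psi y - psi x| <= prim t0 m y - prim t0 m x.
  apply: (dominated_increments false lm acpsi); apply: ae_imp sys => t syst tt tc.
  have [_ _ _ dpsi] := syst (ltW tt) tc.
  by eexists; [exact: dpsi|exact: (rhs_phi false t (ltW tt) tc)].
have mono x : t0 <= x -> x < c -> prim t0 m x <= prim t0 m c.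
  move=> tx xc; rewrite -subr_ge0.
  have m00 s : t0 <= s -> `|0 : R| <= m s by rewrite normr0.
  exact: le_trans (normr_ge0 _) (prim_dominated (loc_integrable0 t0) lm m00 (ltW xc)).
have [lphi hlphi] := dominated_left_limit t0c domphi mono.
have [lpsi hlpsi] := dominated_left_limit t0c dompsi mono.
have m00c s : c <= s -> `|0 : R| <= m s by rewrite normr0.
have limphi :=
  limit_between (glue_dominated t0c lm (loc_integrable0 c) m00c domphi hlphi c).
have limpsi :=
  limit_between (glue_dominated t0c lm (loc_integrable0 c) m00c dompsi hlpsi c).
have lphiK : lphi <= K d c.
  by apply: (limphi _ (acK c)).1 => t tt tc; have [] := ub t tt tc.
have lpsiL : lpsi <= L d c.
  by apply: (limpsi _ (acL c)).1 => t tt tc; have [] := ub t tt tc.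
have lphid : d + d <= lphi.
  by apply: (limphi _ (ac_cst t0 c (d + d))).2 => t tt tc; have [] := floor t tt tc.
have lpsid : d + d <= lpsi.
  by apply: (limpsi _ (ac_cst t0 c (d + d))).2 => t tt tc; have [] := floor t tt tc.
(* half of [eps] is spent on the box, the other half absorbs the variation of [K]
   and [L] shortly after [c] *)
have [k kE] : exists k, k = K d c + eps / 2 := ex_intro _ _ erefl.
have [l lE] : exists l, l = L d c + eps / 2 := ex_intro _ _ erefl.
have e20 : 0 < eps / 2 by rewrite divr_gt0.
have c1' : c <= c + 1 by rewrite lerDl.
have t0c' := ltW t0c.
have box_right (H : R -> R) : abs_continuous t0 (c + 1) H ->
    exists2 r, 0 < r & forall t, c <= t -> t < c + r -> t <= c + 1 -> H c +
      eps / 2 <= H t + eps.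
  move=> acH; have acw := acD acH (ac_cst t0 (c + 1) (eps - (H c + eps / 2))).
  have [|r r0 hr] := ac_gt0_right acw t0c' c1'; first by lra.
  exists r => // t ct tr tc; apply: ltW; have := hr t ct tr tc.
  by rewrite addrA subr_gt0.
have [r1 r10 hr1] := box_right _ (acK (c + 1)).
have [r2 r20 hr2] := box_right _ (acL (c + 1)).
have [e1 e10 [e1r1 e1r2 e11]] : exists2 e1, 0 < e1 & [/\ e1 < r1, e1 < r2 & e1 <= 1].
  pose e := Num.min (Num.min r1 r2) 1.
  have e0 : 0 < e by rewrite !lt_min r10 r20 ltr01.
  have ee : e / 2 < e by rewrite gtr_pMr// invf_lt1// ltr1n.
  exists (e / 2); first by rewrite divr_gt0.
  split; [| |apply: ltW]; apply: lt_le_trans ee _; by rewrite /e !ge_min lexx ?orbT.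
pose b := c + e1.
have cb : c <= b by rewrite lerDl ltW.
have b1 : b <= c + 1 by rewrite lerD2l.
have dlphi : d < lphi by apply: lt_le_trans lphid; rewrite ltrDl.
have dlpsi : d < lpsi by apply: lt_le_trans lpsid; rewrite ltrDl.
have lt_half (x : R) : x < x + eps / 2 by rewrite ltrDl.
have lphik : lphi < k by rewrite kE; exact: le_lt_trans lphiK (lt_half (K d c)).
have lpsil : lpsi < l by rewrite lE; exact: le_lt_trans lpsiL (lt_half (L d c)).
have dk : d <= k by apply/ltW/(lt_trans dlphi).
have dl : d <= l by apply/ltW/(lt_trans dlpsi).
have kK t : c <= t -> t <= b -> k <= K d t + eps /\ l <= L d t + eps.
  move=> ct tb; have tc1 := le_trans tb b1.
  have tr1 : t < c + r1 by apply: le_lt_trans tb _; rewrite ltrD2l.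
  have tr2 : t < c + r2 by apply: le_lt_trans tb _; rewrite ltrD2l.
  by rewrite kE lE; split; [exact: hr1 ct tr1 tc1|exact: hr2 ct tr2 tc1].
have kM : k <= M /\ l <= M.
  have [k1 l1] := kK c (lexx c) cb; have [k2 l2] := leM c t0c' c1'.
  by split; [exact: le_trans k2|exact: le_trans l2].
pose F i t p q := rhs i t (clamp d k p) (clamp d l q).
pose y0 i := if i then lphi else lpsi : R.
have mc (x : R) (lo hi : R) : lo <= hi -> measurable_fun (`[c,
  b]%classic : set cara) (fun=> clamp lo hi x).
  by move=> _; exact: measurable_cst.
have [|||||g [lg gm gE]] := @caratheodory_existence_on c b F m y0 cb.
- move=> i p q.
  have adm G : admissible t0 G ->
      measurable_fun (`[c, b]%classic : set cara) (fun t =>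
        G t (clamp d k p) (clamp d l q)).
    by move=> hG; exact: admissible_clamped_measurable hG t0c' d0 dk dl.
  have mp := mc p d k dk; have mq := mc q d l dl.
  case: i; apply: measurable_funD.
  + exact: (measurable_funM (adm _ hP) mp).
  + exact: (measurable_funM (adm _ hQ) mq).
  + exact: (measurable_funM (adm _ hR) mp).
  + exact: (measurable_funM (adm _ hS) mq).
- move=> i t ct tb; have tt := le_trans t0c' ct.
  have ck : continuous (fun w : R * R => clamp d k w.1).
    by move=> w; apply: (cvg_comp (fun w : R * R =>
      w.1) (clamp d k) _ (@clamp_continuous d k w.1)); exact: cvg_fst.
  have cl : continuous (fun w : R * R => clamp d l w.2).
    by move=> w; apply: (cvg_comp (fun w : R * R =>
      w.2) (clamp d l) _ (@clamp_continuous d l w.2)); exact: cvg_snd.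
  have adm G : admissible t0 G -> continuous (fun w : R * R =>
    G t (clamp d k w.1) (clamp d l w.2)).
    by move=> hG; exact: admissible_clamped_continuous hG tt d0 dk dl.
  move=> w; rewrite /F /rhs; case: i.
    by apply: cvgD; apply: cvgM; [exact: adm hP _|exact: ck|exact: adm hQ _|exact: cl].
  by apply: cvgD; apply: cvgM; [exact: adm hR _|exact: ck|exact: adm hS _|exact: cl].
- exact: loc_integrable_ge lm t0c'.
- by move=> t _; exact: m0.
- move=> i t p q ct tb; have tt := le_trans t0c' ct.
  have [p1 p2] := clamp_itv p dk; have [q1 q2] := clamp_itv q dl.
  have [k1 l1] := kK t ct tb; have [k2 l2] := kM.
  exact: (rhs_dominated i d0 de tt p1 (le_trans p2 k1) q1 (le_trans q2 l1)
    (le_trans p2 k2) (le_trans q2 l2)).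
pose u t := lphi + prim c (g true) t; pose v t := lpsi + prim c (g false) t.
have acu : abs_continuous c b u by apply: acD; [exact: ac_cst|exact: prim_ac].
have acv : abs_continuous c b v by apply: acD; [exact: ac_cst|exact: prim_ac].
have uc : u c = lphi by rewrite /u prim_xx// addr0.
have vc : v c = lpsi by rewrite /v prim_xx// addr0.
have strip (w : R -> R) (lo hi : R) : abs_continuous c b w -> lo < w c -> w c < hi ->
    exists2 r, 0 < r & forall t, c <= t -> t < c + r -> t <= b ->
      lo <= w t /\ w t <= hi.
  move=> acw low whi.
  have aclo := acD acw (acN (ac_cst c b lo)).
  have achi := acD (ac_cst c b hi) (acN acw).
  have [|s1 s10 hs1] := ac_gt0_right aclo (lexx c) cb; first by rewrite subr_gt0.
  have [|s2 s20 hs2] := ac_gt0_right achi (lexx c) cb; first by rewrite subr_gt0.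
  exists (Num.min s1 s2) => [|t ct]; first by rewrite lt_min s10.
  rewrite -ltrBlDl lt_min !ltrBlDl => /andP[ts1 ts2] tb.
  by split; apply: ltW; rewrite -subr_gt0; [exact: hs1|exact: hs2].
have [r3 r30 hr3] := strip u d k acu (eq_ind_r (fun x =>
  d < x) dlphi uc) (eq_ind_r (fun x => x < k) lphik uc).
have [r4 r40 hr4] := strip v d l acv (eq_ind_r (fun x =>
  d < x) dlpsi vc) (eq_ind_r (fun x => x < l) lpsil vc).
pose e2 := Num.min e1 (Num.min r3 r4).
have e20' : 0 < e2 by rewrite !lt_min e10 r30.
have e2b t : t < c + e2 -> [/\ t <= b, t < c + r3 & t < c + r4].
  by rewrite -ltrBlDl !lt_min !ltrBlDl => /and3P[/ltW ? ? ?].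
have box t : c <= t -> t < c + e2 -> [/\ d <= u t, u t <= k, d <= v t & v t <= l].
  move=> ct te; have [tb t3 t4] := e2b t te.
  by have [? ?] := hr3 t ct t3 tb; have [? ?] := hr4 t ct t4 tb.
exists (c + e2)%:E, (glue c phi u), (glue c psi v); split.
- by rewrite lte_fin ltrDl.
- split.
  + by rewrite lte_fin; apply: lt_trans t0c _; rewrite ltrDl.
  + move=> b' _ _; exact: (glue_dominated t0c lm (lg true) (gm true) domphi hlphi b').
  + move=> b' _ _; exact: (glue_dominated t0c lm (lg false) (gm false) dompsi hlpsi b').
  + apply: ae_lam_leb.
    have dg := ae_imp2 (fun t =>
      @conj _ _) (prim_derive (lg true)) (prim_derive (lg false)).
    apply: (ae_imp2 _ (ae_imp2 (fun t => @conj _ _) sys (ae_neq c)) dg).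
    move=> t [syst tc] [dgt dgf] tt; rewrite lte_fin => te.
    have [tltc|ct] := ltP t c.
      have [p1 p2 dp1 dp2] := syst tt tltc.
      have g1 : glue c phi u t = phi t by rewrite /glue tltc.
      have g2 : glue c psi v t = psi t by rewrite /glue tltc.
      by split; rewrite ?g1 ?g2//; exact: glue_derive_left.
    have {}ct : c < t by rewrite lt_neqAle eq_sym tc.
    have g1 : glue c phi u t = u t by rewrite /glue ltNge (ltW ct).
    have g2 : glue c psi v t = v t by rewrite /glue ltNge (ltW ct).
    have [du uk dv vl] := box t (ltW ct) te.
    have [tb _ _] := e2b t te.
    have gt_ i : g i t = rhs i t (u t) (v t).
      by rewrite (gE i t (ltW ct) tb) /F !clamp_id.
    have dadd (x : R) i : is_derive t 1 (prim c (g i)) (g i t) ->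
        is_derive t 1 (fun s => x + prim c (g i) s) (g i t).
      move=> dgi; have := is_deriveD (is_derive_cst x t 1) dgi.
      by rewrite add0r.
    split; rewrite ?g1 ?g2 ?gt_eqF ?(lt_le_trans d0)//.
    * apply: glue_derive_right => //.
      by rewrite -[X in is_derive _ _ _ X]/(rhs true t (u t) (v t)) -gt_;
        exact: dadd (dgt ct).
    * apply: glue_derive_right => //.
      by rewrite -[X in is_derive _ _ _ X]/(rhs false t (u t) (v t)) -gt_;
        exact: dadd (dgf ct).
- by move=> t _; rewrite lte_fin /glue => ->.
Qed.

End continuation_theorem.

End positive_solutions.

Theorem theorem3p3 (R : realType) (t0 : R)
    (P Q Rf S : R -> R -> R -> R)
    (alpha beta : R -> R)
    (Pd Qd Rd Sd B1d B2d : R -> R -> R)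
    (hP : admissible t0 P) (hQ : admissible t0 Q)
    (hR : admissible t0 Rf) (hS : admissible t0 S)
    (halpha : loc_integrable t0 alpha) (hbeta : loc_integrable t0 beta)
    (hd : forall delta : R, 0 < delta ->
       [/\ loc_integrable t0 (Pd delta), loc_integrable t0 (Qd delta) &
           loc_integrable t0 (Rd delta)] /\
       [/\ loc_integrable t0 (Sd delta), loc_integrable t0 (B1d delta) &
           loc_integrable t0 (B2d delta)])
    (c1 c2 eps : R) (hc1 : 0 < c1) (hc2 : 0 < c2) (heps : 0 < eps)
    (hbounds : forall delta t u v : R,
       0 < delta -> delta < eps -> t0 <= t ->
       delta <= u ->
       u <= Kbound t0 (Pd delta) (Qd delta) (Rd delta) (B1d delta) t c1 c2
            + eps ->
       delta <= v ->
       v <= Lbound t0 (Sd delta) (Rd delta) (Qd delta) (B2d delta) t c1 c2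
            + eps ->
       [/\ alpha t <= P t u v <= Pd delta t,
           beta t <= S t u v <= Sd delta t,
           0 <= Q t u v <= Qd delta t,
           0 <= Rf t u v <= Rd delta t &
           B1d delta t <= P t u v - S t u v <= B2d delta t])
    (T : \bar R) (phi psi : R -> R)
    (hsol : max_existence_interval P Q Rf S t0 T phi psi)
    (hphi0 : phi t0 = c1) (hpsi0 : psi t0 = c2) :
  T = +oo%E /\ (forall t : R, t0 <= t -> 0 < phi t /\ 0 < psi t).
Proof.
have [sol nocont] := hsol.
have [t0T acphi acpsi sys] := sol.
have TE : T = +oo%E.
  clear hsol acphi acpsi sys; case: T sol nocont t0T => [c| |] //.
  rewrite lte_fin => sol nocont t0c; exfalso; apply: nocont.
  have [T' [phi' [psi' [cT' sol' agree]]]] := solution_continues hP hQ hR hS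
    halpha hbeta hd hc1 hc2 heps hbounds t0c sol hphi0 hpsi0.
  by exists T', phi', psi'.
split=> // t t0t.
have tT : (t%:E < T)%E by rewrite TE ltry.
have syst : {ae @lebesgue_measure R, forall s, t0 < s -> s < t ->
    satisfies_system P Q Rf S phi psi s}.
  apply: ae_imp (ae_leb_lam sys) => s h t0s st.
  by apply: h; [exact: ltW|rewrite TE ltry].
have [l1 l2] := solution_lower_bounds halpha hbeta hd hc1 hc2 heps hbounds t0t
  (acphi t t0t tT) (acpsi t t0t tT) hphi0 hpsi0 syst t0t (lexx t).
by split; [apply: lt_le_trans l1|apply: lt_le_trans l2]; rewrite mulr_gt0// expR_gt0.
Qed.
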